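(* Let $\mathcal{S}\subset\mathcal{P}(p)$ be a convex set, and let $\mathbf{x}_1,\mathbf{x}_2,\dots$ be i.i.d. copies of a zero-mean, elliptically distributed random vector $\mathbf{x}$ in $\mathbb{R}^p$ whose shape matrix $\mathbf{C}^{\text{True}}$ belongs to $\mathcal{S}$ (with its scale fixed by $\mathrm{Tr}(\mathbf{C}^{\text{True}})=1$). Then the COCA estimator with structure set $\mathcal{S}$, computed from $\mathbf{x}_1,\dots,\mathbf{x}_n$, is an asymptotically consistent estimator of $\mathbf{C}^{\text{True}}$ as $n\to\infty$ (with $p$ fixed), i.e. $\mathbf{C}^{\text{COCA}}\to\mathbf{C}^{\text{True}}$ in probability.
   Context: $\mathcal{P}(p)$ denotes the closed cone of symmetric positive semi-definite $p\times p$ matrices, and $\succeq$ is the Loewner order ($A\succeq B$ iff $A-B$ is positive semi-definite). Elliptical distribution: $\mathbf{x}=r\,\mathbf{\Lambda}\,\mathbf{u}$, where $\mathbf{\Lambda}\in\mathbb{R}^{p\times k}$ is a fixed matrix, $\mathbf{u}$ is a random vector uniformly distributed on the unit sphere of $\mathbb{R}^k$, and $r$ is a nonnegative random variable (of unknown distribution), stochastically independent of $\mathbf{u}$. The shape matrix is $\mathbf{C}^{\text{True}}=\mathbf{\Lambda}\mathbf{\Lambda}^T$; since the distribution of $r$ is arbitrary, it is determined only up to a positive scaling factor. It is assumed that $\mathbf{C}^{\text{True}}$ is invertible and that $r>0$ almost surely. COCA estimator: for a convex set $\mathcal{S}\subseteq\mathcal{P}(p)$, let $\mathcal{S}_1=\{\mathbf{M}\in\mathcal{S}:\mathrm{Tr}(\mathbf{M})=1\}$.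 With $\|\cdot\|$ some norm on $p\times p$ matrices, $\mathbf{C}^{\text{COCA}}$ (depending on $n$) is the $\mathbf{C}$-component of a solution of $$\min_{\mathbf{C}\in\mathcal{S}_1,\ d_1,\dots,d_n\in\mathbb{R}}\ \Big\|\mathbf{C}-\frac1n\sum_{i=1}^n d_i\,\mathbf{x}_i\mathbf{x}_i^T\Big\|\quad\text{subject to}\quad \mathbf{C}\succeq\frac1p\,d_i\,\mathbf{x}_i\mathbf{x}_i^T,\quad d_i\ge 0,\quad i=1,\dots,n.$$ For positive definite $\mathbf{C}$ and $\mathbf{x}_i\neq 0$ the matrix inequality is equivalent to $d_i\le p/(\mathbf{x}_i^T\mathbf{C}^{-1}\mathbf{x}_i)$. *)

(* Defs.v *)
From HB Require Import structures.
From mathcomp Require Import all_boot all_order all_algebra finmap.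
From mathcomp Require Import all_classical all_reals all_analysis.

Set Implicit Arguments.
Unset Strict Implicit.
Unset Printing Implicit Defensive.

Import Order.TTheory GRing.Theory Num.Theory.
Import numFieldNormedType.Exports.

Local Open Scope classical_set_scope.
Local Open Scope ring_scope.

Section Matrices.
Context {R : realType}.

Definition psd (p : nat) (M : 'M[R]_p) : Prop :=
  M^T = M /\ forall v : 'cV[R]_p, 0 <= (v^T *m M *m v) 0 0.

Definition loewner_ge (p : nat) (A B : 'M[R]_p) : Prop := psd (A - B).

Definition is_norm (V : lmodType R) (N : V -> R) : Prop :=
  [/\ forall v w, N (v + w) <= N v + N w,
      forall (a : R) v, N (a *: v) = `|a| * N v
    & forall v, N v = 0 -> v = 0].

End Matrices.

(* R^n with its Borel sigma-algebra *)
Notation borel_cV R n := (g_sigma_algebraType (@open 'cV[R]_n)).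

Section RandomVectors.
Context {R : realType}.

(* Only measurable A are tested: off the sigma-algebra the values of a
   measure of the library are unconstrained. *)
Definition same_law d1 d2 d' (T1 : measurableType d1) (T2 : measurableType d2)
    (E : measurableType d') (P1 : probability T1 R) (P2 : probability T2 R)
    (X1 : {RV P1 >-> E}) (X2 : {RV P2 >-> E}) : Prop :=
  forall A : set E, measurable A ->
    distribution P1 X1 A = distribution P2 X2 A.

Definition independent_pair d d1 d2 (T : measurableType d)
    (E1 : measurableType d1) (E2 : measurableType d2) (P : probability T R)
    (X : {RV P >-> E1}) (Y : {RV P >-> E2}) : Prop :=
  forall (A : set E1) (B : set E2), measurable A -> measurable B ->
    P (X @^-1` A `&` Y @^-1` B) = (P (X @^-1` A) * P (Y @^-1` B))%E.

Definition mutually_independent d d' (T : measurableType d)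
    (E : measurableType d') (P : probability T R) (I : choiceType)
    (X : I -> {RV P >-> E}) : Prop :=
  forall (J : {fset I}) (A : I -> set E), (forall i, measurable (A i)) ->
    P (\bigcap_(i in [set` J]) (X i @^-1` A i)) =
    (\prod_(i <- J) P (X i @^-1` A i))%E.

(* The uniform distribution on the Euclidean unit sphere of R^k is the
   probability measure carried by the sphere and invariant under the
   orthogonal group (normalised surface measure). *)
Definition uniform_on_sphere d (T : measurableType d) (P : probability T R)
    (k : nat) (u : {RV P >-> borel_cV R k}) : Prop :=
  {ae P, forall w, ((u w : 'cV[R]_k)^T *m (u w : 'cV[R]_k)) 0 0 = 1} /\
  forall Q : 'M[R]_k, Q^T *m Q = 1%:M ->
  forall A : set (borel_cV R k), measurable A ->
    P [set w | A (Q *m (u w : 'cV[R]_k))] = P [set w | A (u w)].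

(* Zero mean means centred at the origin: r need not have any moment. C is a
   shape matrix of x; any positive multiple of C is one too, the factor being
   absorbed into r. *)
Definition elliptical d (T : measurableType d) (P : probability T R)
    (p : nat) (x : {RV P >-> borel_cV R p}) (C : 'M[R]_p) : Prop :=
  exists (k : nat) (Lambda : 'M[R]_(p, k))
         (r : {RV P >-> R}) (u : {RV P >-> borel_cV R k}),
    [/\ uniform_on_sphere u,
        (forall w, 0 <= r w) /\ {ae P, forall w, 0 < r w},
        independent_pair r u,
        forall w, x w = r w *: (Lambda *m (u w : 'cV[R]_k))
      & C = Lambda *m Lambda^T].

(* Stated with the outer measure of P, so as to make sense without
   measurability of X n; see cvg_in_probabilityE. *)
Definition cvg_in_probability d (T : measurableType d) (P : probability T R)
    (V : normedModType R) (X : nat -> T -> V) (l : V) : Prop :=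
  forall eps : R, 0 < eps ->
    (P^*)%mu [set w | eps <= `|X n w - l|] @[n --> \oo] --> 0%E.

Lemma cvg_in_probabilityE d (T : measurableType d) (P : probability T R)
    (V : normedModType R) (X : nat -> T -> V) (l : V) :
  (forall n (eps : R), measurable [set w | eps <= `|X n w - l|]) ->
  cvg_in_probability P X l <->
  (forall eps : R, 0 < eps ->
     P [set w | eps <= `|X n w - l|] @[n --> \oo] --> 0%E).
Proof.
move=> mX.
have PE eps : (fun n => (P^*)%mu [set w | eps <= `|X n w - l|]) =
              (fun n => P [set w | eps <= `|X n w - l|]).
  by apply/funext => n; exact: measurable_mu_extE.
by split=> XP eps /XP; rewrite PE.
Qed.

End RandomVectors.

Section COCA.
Context {R : realType}.
Variables (p : nat) (S : set 'M[R]_p) (N : 'M[R]_p -> R).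
Variables (n : nat) (x : 'I_n -> 'cV[R]_p).

Definition coca_feasible (C : 'M[R]_p) (d : 'I_n -> R) : Prop :=
  [/\ S C, \tr C = 1,
      forall i, loewner_ge C ((p%:R^-1 * d i) *: (x i *m (x i)^T))
    & forall i, 0 <= d i].

Definition coca_objective (C : 'M[R]_p) (d : 'I_n -> R) : R :=
  N (C - n%:R^-1 *: \sum_(i < n) d i *: (x i *m (x i)^T)).

Definition coca_solution (C : 'M[R]_p) (d : 'I_n -> R) : Prop :=
  coca_feasible C d /\
  forall C' d', coca_feasible C' d' ->
    coca_objective C d <= coca_objective C' d'.

Definition coca_estimate (C : 'M[R]_p) : Prop :=
  exists d : 'I_n -> R, coca_solution C d.

End COCA.

(* Main.v *)
Require Import Defs.
From HB Require Import structures.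
From mathcomp Require Import all_boot all_order all_algebra fingroup perm finmap.
From mathcomp Require Import all_classical all_reals all_analysis.
From mathcomp Require Import measurable_realfun.
From mathcomp Require Import ring lra.

Set Implicit Arguments.
Unset Strict Implicit.
Unset Printing Implicit Defensive.

Import Order.TTheory GRing.Theory Num.Theory.
Import numFieldNormedType.Exports.

Local Open Scope classical_set_scope.
Local Open Scope ring_scope.

(** The sample is whitened: with [Ctrue = B *m B^T], a positive multiple of
    [B^-1 x] is distributed as [W u], where [u] is uniform on a sphere and
    [W *m W^T] is the identity. The unknown radius disappears by working only with
    the projection [dirmx] onto the line spanned by a sample. Write [z_i] for the
    whitened samples, [y_i = z_i / |z_i|] and [D] for the whitened estimate.

    The true shape matrix, with the largest weights it allows, is feasible, and
    its residual is a congruence of [1 - p * mean (y_i y_i^T)]. By the law of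
    large numbers this tends to zero, since the expectation of [y y^T] is [1 / p];
    by optimality the residual of the estimate tends to zero too. Taking traces,
    the mean of the rescaled weights [delta_i = d_i |z_i|^2] is asymptotically
    [\tr D].

    On the other hand feasibility gives [delta_i <= p * v^T D v] for every vector
    [v] with [v^T y_i = 1], in particular for [v = y_i + s h(y_i) A y_i] with [A]
    skew-symmetric and [h] a bounded even function. This bound is linear in [D],
    so that only finitely many averages are involved although [D] depends on the
    sample, and no uniform law of large numbers over the structure set is needed.
    Averaging, and comparing with the previous paragraph, gives

      [0 <= 2 s * \tr (D A H) + O(s^2) + o(1)], where [H] is the expectation of
      [h(y) y y^T].

    As [s] may have either sign, [\tr (D A H)] tends to zero. Taking for [A] the
    generator of the rotations in the plane of coordinates [a] and [b], the weight
    [h = y_a y_b] turns this into [D_aa - D_bb --> 0] and the weight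
    [h = y_b^2 - y_a^2] into [D_ab --> 0], up to positive factors. Hence [D] is
    asymptotically scalar, the estimate is asymptotically proportional to [Ctrue],
    and the normalisation of the trace makes the limit [Ctrue].

    The moments [H] are computed from the invariance of the law of [y] under sign
    changes of coordinates. The factors are positive because [u] almost surely
    avoids any given hyperplane ([uniform_hyperplane_null]). The deterministic
    part of the argument is [coca_near], the convergence of the averages is
    [weak_law_of_large_numbers]. *)

(** * Comparison of matrix norms *)

Section MatrixNorm.
Context {R : realType}.

Lemma ler_mx_entry m n (M : 'M[R]_(m, n)) i j : `|M i j| <= `|M|.
Proof.
rewrite [leRHS]/Num.norm /= mx_normrE.
by apply/bigmax_geP; right => /=; exists (i, j).
Qed.

Lemma mx_norm_le m n (M : 'M[R]_(m, n)) c :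
  0 <= c -> (forall i j, `|M i j| <= c) -> `|M| <= c.
Proof.
move=> c0 Mc; rewrite [leLHS]/Num.norm /= mx_normrE.
by apply/bigmax_leP; split => // -[i j] _ /=.
Qed.

Lemma ler_mx_normM m n q (A : 'M[R]_(m, n)) (B : 'M[R]_(n, q)) :
  `|A *m B| <= n%:R * (`|A| * `|B|).
Proof.
apply: mx_norm_le => [|i j]; first by rewrite !mulr_ge0.
rewrite mxE (le_trans (ler_norm_sum _ _ _))//.
rewrite -[X in X%:R]card_ord mulr_natl -sumr_const ler_sum// => k _.
by rewrite normrM ler_pM// ler_mx_entry.
Qed.

Lemma ler_mx_tr n (A : 'M[R]_n) : `|\tr A| <= n%:R * `|A|.
Proof.
rewrite /mxtrace (le_trans (ler_norm_sum _ _ _))//.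
rewrite -[X in X%:R]card_ord mulr_natl -sumr_const ler_sum// => k _.
exact: ler_mx_entry.
Qed.

(** Only values at the finitely many unit matrices matter. *)
Lemma ler_seminorm_mx_norm m n (f : 'M[R]_(m, n) -> R) :
  (forall v w, f (v + w) <= f v + f w) ->
  (forall (a : R) v, f (a *: v) = `|a| * f v) ->
  exists2 K, 0 <= K & forall M, f M <= K * `|M|.
Proof.
move=> fD fZ.
have f0 : f 0 = 0 by rewrite -(scale0r 0) fZ normr0 mul0r.
have f_ge0 v : 0 <= f v.
  have := fD v (- v); rewrite subrr f0 -scaleN1r fZ normrN1 mul1r.
  by rewrite -mulr2n pmulrn_lge0.
exists (\sum_i \sum_j f (delta_mx i j)).
  by apply: sumr_ge0 => i _; apply: sumr_ge0 => j _.
move=> M; have fsum I (r : seq I) (F : I -> 'M[R]_(m, n)) :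
    f (\sum_(i <- r) F i) <= \sum_(i <- r) f (F i).
  elim: r => [|i r IH]; first by rewrite !big_nil f0.
  by rewrite !big_cons (le_trans (fD _ _))// lerD2l.
rewrite {1}(matrix_sum_delta M) (le_trans (fsum _ _ _))// mulr_suml ler_sum//.
move=> i _; rewrite (le_trans (fsum _ _ _))// mulr_suml ler_sum// => j _.
by rewrite fZ mulrC ler_wpM2l// ler_mx_entry.
Qed.

(** The norm is continuous and does not vanish on the compact unit sphere of
    the entrywise sup norm, hence is bounded below there by some positive
    constant. The argument is carried out on row vectors, through [mxvec]. *)
Lemma ler_mx_norm_is_norm n (N : 'M[R]_n -> R) : is_norm N ->
  exists2 K, 0 <= K & forall M, `|M| <= K * N M.
Proof.
move=> [ND NZ N0].
have [K1 K1_ge0 NK1] := ler_seminorm_mx_norm ND NZ.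
have Nzero : N 0 = 0 by rewrite -(scale0r 0) NZ normr0 mul0r.
have N_ge0 v : 0 <= N v.
  have := ND v (- v); rewrite subrr Nzero -scaleN1r NZ normrN1 mul1r.
  by rewrite -mulr2n pmulrn_lge0.
have vec_le (v : 'rV[R]_(n * n)) : `|vec_mx v| <= `|v|.
  by apply: mx_norm_le => // i j; rewrite mxE ler_mx_entry.
have vec_ge (v : 'rV[R]_(n * n)) : `|v| <= `|vec_mx v|.
  apply: mx_norm_le => // i j; rewrite ord1.
  by case/mxvec_indexP: j => a b; rewrite -{1}(vec_mxK v) mxvecE ler_mx_entry.
pose g (v : 'rV[R]_(n * n)) := N (vec_mx v).
have g_lip v w : `|g v - g w| <= K1 * `|v - w|.
  rewrite (@le_trans _ _ (N (vec_mx (v - w))))//; last first.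
    by rewrite (le_trans (NK1 _))// ler_wpM2l.
  rewrite ler_norml /g; apply/andP; split.
    rewrite lerBrDl; have := ND (vec_mx v) (vec_mx (w - v)).
    rewrite -linearD /= addrC subrK.
    rewrite -[w - v]opprB linearN /= -scaleN1r NZ normrN1 mul1r /=; lra.
  have := ND (vec_mx w) (vec_mx (v - w)).
  rewrite -linearD /= addrC subrK /=; lra.
have g_cont : continuous g.
  move=> v; apply/(@cvgrPdist_lt _ _ _ (nbhs v)) => e e0.
  have K1p : 0 < K1 + 1 by rewrite ltr_wpDl.
  near=> w.
  rewrite (le_lt_trans (g_lip _ _))//.
  have : `|v - w| < e / (K1 + 1).
    by near: w; apply: (@cvgr_dist_lt _ _ _ (nbhs v)) => //; rewrite divr_gt0.
  rewrite ltr_pdivlMr// mulrC; apply: le_lt_trans.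
  by rewrite ler_wpM2r// lerDl.
pose sph := [set v : 'rV[R]_(n * n) | `|v| = 1].
have sph_normalize M : M != 0 -> sph (mxvec (`|M|^-1 *: M)).
  move=> M0; apply/eqP; rewrite eq_le (le_trans (vec_ge _)) /=; last first.
    by rewrite mxvecK normrZ ger0_norm ?invr_ge0// mulVf// normr_eq0.
  rewrite (le_trans _ (vec_le _))// mxvecK normrZ ger0_norm ?invr_ge0//.
  by rewrite mulVf// normr_eq0.
have cpt : compact sph.
  apply: bounded_closed_compact.
    exists 1; split; first exact: num_real.
    by move=> x x1 v /= ->; exact: ltW.
  have -> : sph = (fun v : 'rV[R]_(n * n) => `|v|) @^-1` [set 1] by [].
  apply: closed_comp; last exact: closed_eq.
  by move=> v _; exact: norm_continuous.
have [[v0 sv0]|sph0] := pselect (sph !=set0); last first.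
  exists 0 => // M; rewrite mul0r normr_le0; apply: contrapT => /negP M0.
  by apply: sph0; exists (mxvec (`|M|^-1 *: M)); exact: sph_normalize.
have [c /set_mem sc gc] :
    exists2 c, c \in sph & forall t, t \in sph -> g c <= g t.
  apply: compact_EVT_min => //; first by exists v0.
  exact/continuous_subspaceT/g_cont.
have gc0 : 0 < g c.
  rewrite lt0r N_ge0 andbT; apply/eqP => /N0 vc0.
  have : `|c| = 0 by rewrite -(vec_mxK c) vc0 linear0 normr0.
  by rewrite sc => /eqP; rewrite oner_eq0.
exists (g c)^-1 => [|M]; first by rewrite invr_ge0 ltW.
have [->|M0] := eqVneq M 0; first by rewrite normr0 Nzero mulr0.
have nM : 0 < `|M| by rewrite normr_gt0.
have : g c <= g (mxvec (`|M|^-1 *: M)).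
  by apply: gc; apply/mem_set; exact: sph_normalize.
rewrite /g mxvecK NZ ger0_norm ?invr_ge0// ler_pdivlMl// => h.
by rewrite mulrC ler_pdivlMr.
Unshelve. all: by end_near.
Qed.
End MatrixNorm.

(** * Cholesky factors and projections onto lines *)

Section PositiveSemidefinite.
Context {R : realType}.

Lemma quad_delta n (M : 'M[R]_n) i j :
  ((delta_mx i 0 : 'cV_n)^T *m M *m (delta_mx j 0 : 'cV_n)) 0 0 = M i j.
Proof. by rewrite trmx_delta -rowE -colE !mxE. Qed.

Lemma psd_diag_ge0 n (M : 'M[R]_n) i : psd M -> 0 <= M i i.
Proof. by case=> _ /(_ (delta_mx i 0)); rewrite quad_delta. Qed.

(** Testing at [e_i + e_j] and at [e_i - e_j] bounds twice an entry by the sum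
    of two diagonal entries. *)
Lemma ler_mx_norm_psd n (M : 'M[R]_n) : psd M -> `|M| <= \tr M.
Proof.
move=> psdM; have M0 i := psd_diag_ge0 i psdM; case: psdM => symM posM.
have tr_ge0 : 0 <= \tr M by apply: sumr_ge0 => i _; exact: M0.
have le_tr i : M i i <= \tr M.
  by rewrite /mxtrace (bigD1 i)//= lerDl sumr_ge0.
have symE i j : M j i = M i j by rewrite -{1}symM mxE.
apply: mx_norm_le => // i j.
have addE (A B : 'M[R]_1) : (A + B) 0 0 = A 0 0 + B 0 0 by rewrite mxE.
have scaleE c (A : 'M[R]_1) : (c *: A) 0 0 = c * A 0 0 by rewrite mxE.
have q c : 0 <= M i i + c * M i j *+ 2 + c ^+ 2 * M j j.
  have := posM (delta_mx i 0 + c *: delta_mx j 0).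
  rewrite [(_ + _)^T]linearD/= [(_ *: _)^T]linearZ/=.
  rewrite !(mulmxDl, mulmxDr) -!scalemxAl -!scalemxAr.
  move=> /le_trans; apply; rewrite !(addE, scaleE) !quad_delta symE.
  by rewrite le_eqVlt; apply/orP; left; apply/eqP; ring.
have := q 1; have := q (- 1); have := le_tr i; have := le_tr j.
by rewrite ler_norml; lra.
Qed.

(** The Schur complement of the first pivot of a positive definite matrix is
    positive definite, so the factor can be built one column at a time. *)
Lemma cholesky n (C : 'M[R]_n) : C^T = C ->
  (forall v : 'cV_n, v != 0 -> 0 < (v^T *m C *m v) 0 0) ->
  exists2 B, B \in unitmx & C = B *m B^T.
Proof.
elim: n C => [C _ _|n IH C symC posC].
  by exists 1%:M; [exact: unitmx1|rewrite [LHS]flatmx0 [RHS]flatmx0].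
pose D : 'M[R]_(1 + n) := C.
have posD (v : 'cV[R]_(1 + n)) : v != 0 -> 0 < (v^T *m D *m v) 0 0 := posC v.
pose a := ulsubmx D 0 0; pose b := dlsubmx D; pose e := drsubmx D.
have ulE : ulsubmx D = a%:M by rewrite [LHS]mx11_scalar.
have urE : ursubmx D = b^T.
  by rewrite /b trmx_dlsub [D^T]symC.
have DE : D = block_mx a%:M b^T b e by rewrite -ulE -urE submxK.
have a0 : 0 < a.
  have := posD (col_mx 1%:M 0).
  rewrite DE tr_col_mx mul_row_block mul_row_col.
  rewrite !(trmx0, trmx1, mul0mx, mulmx0, addr0, mul1mx, mulmx1).
  rewrite mxE eqxx mulr1n; apply; apply/eqP => /(congr1 usubmx)/matrixP/(_ 0 0).
  by rewrite col_mxKu linear0 !mxE eqxx => /eqP; rewrite oner_eq0.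
pose s := Num.sqrt a; have s0 : 0 < s by rewrite sqrtr_gt0.
have ss : s * s = a by rewrite -expr2 sqr_sqrtr// ltW.
have [||B' uB' SE] := IH (e - a^-1 *: (b *m b^T)).
- rewrite linearB/= linearZ/= trmx_mul trmxK; congr (_ - _).
  by rewrite /e trmx_drsub [D^T]symC.
- move=> w w0; pose v : 'cV_(1 + n) := col_mx (- a^-1 *: (b^T *m w)) w.
  have := posD v; rewrite DE /v tr_col_mx mul_row_block mul_row_col.
  have -> : (- a^-1 *: (b^T *m w))^T = - a^-1 *: (w^T *m b).
    by rewrite linearZ/= trmx_mul trmxK.
  rewrite scalar_mxC mul_scalar_mx scalerA mulrN divff ?gt_eqF// scaleN1r.
  rewrite addNr mul0mx add0r mulmxBr mulmxDl mulmxBl addrC.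
  rewrite -!scalemxAl -!scalemxAr -!scalemxAl !scaleNr !mulmxA; apply.
  apply: contra_neq w0 => /(congr1 dsubmx).
  by rewrite col_mxKd linear0.
pose B : 'M[R]_(1 + n) := block_mx s%:M 0 (s^-1 *: b) B'.
have detB : \det B = s * \det B' by rewrite det_lblock det_scalar1.
have DB : D = B *m B^T.
  rewrite DE tr_block_mx mulmx_block tr_scalar_mx trmx0 linearZ/=.
  rewrite !(mul0mx, mulmx0, addr0) -scalar_mxM ss mul_scalar_mx mul_mx_scalar.
  rewrite !scalerA divff ?mulVf ?gt_eqF// !scale1r -SE -scalemxAl -scalemxAr.
  by rewrite scalerA -invfM ss addrC subrK.
exists B; last exact: DB.
by rewrite unitmxE [X in X \in _]detB unitrM unitfE gt_eqF.
Qed.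

End PositiveSemidefinite.

Section Direction.
Context {R : realType}.

Definition sqnorm n (z : 'cV[R]_n) : R := (z^T *m z) 0 0.

(** The orthogonal projection onto the line spanned by [z], which carries the
    direction of [z] up to sign and forgets its length. Division by zero makes
    it [0] at the origin, so that the identities below need no side condition. *)
Definition dirmx n (z : 'cV[R]_n) : 'M[R]_n := (sqnorm z)^-1 *: (z *m z^T).

Lemma sqnormE n (z : 'cV[R]_n) : sqnorm z = \sum_i z i 0 ^+ 2.
Proof. by rewrite /sqnorm mxE; apply: eq_bigr => i _; rewrite mxE expr2. Qed.

Lemma sqnormZ n c (z : 'cV[R]_n) : sqnorm (c *: z) = c ^+ 2 * sqnorm z.
Proof.
by rewrite !sqnormE mulr_sumr; apply: eq_bigr => i _; rewrite mxE exprMn.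
Qed.

Lemma sqnorm_ge0 n (z : 'cV[R]_n) : 0 <= sqnorm z.
Proof. by rewrite sqnormE sumr_ge0// => i _; exact: sqr_ge0. Qed.

Lemma sqnorm_eq0 n (z : 'cV[R]_n) : (sqnorm z == 0) = (z == 0).
Proof.
apply/eqP/eqP => [|->]; last by rewrite /sqnorm mulmx0 mxE.
rewrite sqnormE => /eqP; rewrite psumr_eq0 => [/allP z0|i _]; last exact: sqr_ge0.
apply/colP => i; have := z0 i (mem_index_enum _).
by rewrite /= sqrf_eq0 mxE => /eqP.
Qed.

Lemma mulmx_trl_col n (z : 'cV[R]_n) : z^T *m z = (sqnorm z)%:M.
Proof. exact: mx11_scalar. Qed.

Lemma dirmxE n (z : 'cV[R]_n) i j : dirmx z i j = (sqnorm z)^-1 * (z i 0 * z j 0).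
Proof. by rewrite !mxE big_ord1 !mxE. Qed.

Lemma trmx_dirmx n (z : 'cV[R]_n) : (dirmx z)^T = dirmx z.
Proof. by rewrite linearZ/= trmx_mul trmxK. Qed.

Lemma mxtrace_mul_col n (z w : 'cV[R]_n) : \tr (z *m w^T) = (w^T *m z) 0 0.
Proof. by rewrite mxtrace_mulC /mxtrace big_ord1. Qed.

Lemma mxtrace_dirmx n (z : 'cV[R]_n) : z != 0 -> \tr (dirmx z) = 1.
Proof.
move=> z0; rewrite linearZ/= mxtrace_mul_col -/(sqnorm z) mulVf//.
by rewrite sqnorm_eq0.
Qed.

Lemma dirmx0 n : dirmx (0 : 'cV[R]_n) = 0.
Proof. by rewrite /dirmx mul0mx scaler0. Qed.

Lemma dirmxZ n c (z : 'cV[R]_n) : c != 0 -> dirmx (c *: z) = dirmx z.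
Proof.
move=> c0; have cT : (c *: z)^T = c *: z^T by rewrite linearZ.
rewrite /dirmx sqnormZ cT -scalemxAl -scalemxAr !scalerA; congr (_ *: _).
by rewrite expr2 !invfM; move: (sqnorm z)^-1 => s; field.
Qed.

Lemma dirmx_idem n (z : 'cV[R]_n) : dirmx z *m dirmx z = dirmx z.
Proof.
have [->|z0] := eqVneq z 0; first by rewrite dirmx0 mulmx0.
rewrite /dirmx -scalemxAl -scalemxAr mulmxA -[z *m z^T *m z]mulmxA.
rewrite mulmx_trl_col mul_mx_scalar -scalemxAl !scalerA; congr (_ *: _).
by rewrite mulVf ?sqnorm_eq0// mulr1.
Qed.

Lemma dirmx_orth n (Q : 'M[R]_n) (z : 'cV[R]_n) :
  Q^T *m Q = 1%:M -> dirmx (Q *m z) = Q *m dirmx z *m Q^T.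
Proof.
move=> QQ; rewrite /dirmx -scalemxAr -scalemxAl /sqnorm trmx_mul !mulmxA.
by rewrite -[z^T *m Q^T *m Q]mulmxA QQ mulmx1.
Qed.

Lemma ler_norm_dirmx n (z : 'cV[R]_n) i j : `|dirmx z i j| <= 1.
Proof.
have [->|z0] := eqVneq z 0; first by rewrite dirmx0 mxE normr0.
have zi k : z k 0 ^+ 2 <= sqnorm z.
  by rewrite sqnormE (bigD1 k)//= lerDl sumr_ge0// => l _; exact: sqr_ge0.
have s0 : 0 < sqnorm z by rewrite lt0r sqnorm_eq0 z0 sqnorm_ge0.
rewrite dirmxE normrM (@ger0_norm _ _^-1) ?invr_ge0 ?sqnorm_ge0// mulrC.
rewrite ler_pdivrMr// mul1r; have := zi i; have := zi j.
have := sqr_ge0 (z i 0 + z j 0); have := sqr_ge0 (z i 0 - z j 0).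
by rewrite ler_norml !expr2; nra.
Qed.

End Direction.

(** * Expectations of bounded random variables *)

Section BoundedMeasurable.
Context d (T : measurableType d) (R : realType).
Implicit Types f g : T -> R.

Definition bounded_measurable f :=
  measurable_fun setT f /\ exists M, forall x, `|f x| <= M.

Lemma bounded_measurable_cst c : bounded_measurable (fun=> c).
Proof. by split; [exact: measurable_cst|exists `|c|]. Qed.

Lemma bounded_measurableD f g : bounded_measurable f -> bounded_measurable g ->
  bounded_measurable (fun x => f x + g x).
Proof.
move=> [mf [M fM]] [mg [K gK]]; split; first exact: measurable_funD.
by exists (M + K) => x; rewrite (le_trans (ler_normD _ _))// lerD.
Qed.

Lemma bounded_measurableM f g : bounded_measurable f -> bounded_measurable g ->
  bounded_measurable (fun x => f x * g x).
Proof.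
move=> [mf [M fM]] [mg [K gK]]; split; first exact: measurable_funM.
by exists (M * K) => x; rewrite normrM ler_pM.
Qed.

Lemma bounded_measurableB f g : bounded_measurable f -> bounded_measurable g ->
  bounded_measurable (fun x => f x - g x).
Proof.
move=> bf bg; under [X in bounded_measurable X]eq_fun do rewrite -mulN1r.
by apply: bounded_measurableD => //; apply: bounded_measurableM => //;
  exact: bounded_measurable_cst.
Qed.

Lemma bounded_measurable_sum I (r : seq I) (F : I -> T -> R) :
  (forall i, bounded_measurable (F i)) ->
  bounded_measurable (fun x => \sum_(i <- r) F i x).
Proof.
move=> bF; elim: r => [|i r IH].
  by under [X in bounded_measurable X]eq_fun do rewrite big_nil;
    exact: bounded_measurable_cst.
under [X in bounded_measurable X]eq_fun do rewrite big_cons.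
exact: bounded_measurableD.
Qed.

End BoundedMeasurable.

Lemma bounded_measurable_comp d d' (T : measurableType d) (E : measurableType d')
    (R : realType) (f : E -> R) (X : T -> E) :
  measurable_fun setT X -> bounded_measurable f -> bounded_measurable (f \o X).
Proof.
move=> mX [mf [M fM]]; split; first exact: measurableT_comp.
by exists M => x; exact: fM.
Qed.

Section BoundedExpectation.
Context d (T : measurableType d) (R : realType) (P : probability T R).
Implicit Types f g : T -> R.

Lemma bounded_measurable_integrable f :
  bounded_measurable f -> P.-integrable setT (EFin \o f).
Proof.
move=> [mf [M fM]]; apply: measurable_bounded_integrable => //.
  by rewrite -ge0_fin_numE ?fin_num_measure.
exists M; split; rewrite ?num_real// => x Mx y _ /=.
by rewrite (le_trans (fM _)) ?ltW.
Qed.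

Lemma bounded_expectationD f g : bounded_measurable f -> bounded_measurable g ->
  \int[P]_x (f x + g x) = \int[P]_x f x + \int[P]_x g x.
Proof. by move=> *; rewrite RintegralD//; exact: bounded_measurable_integrable. Qed.

Lemma bounded_expectationB f g : bounded_measurable f -> bounded_measurable g ->
  \int[P]_x (f x - g x) = \int[P]_x f x - \int[P]_x g x.
Proof. by move=> *; rewrite RintegralB//; exact: bounded_measurable_integrable. Qed.

Lemma bounded_expectationZ c f : bounded_measurable f ->
  \int[P]_x (c * f x) = c * \int[P]_x f x.
Proof. by move=> *; rewrite RintegralZl//; exact: bounded_measurable_integrable. Qed.

Lemma expectation_cstr (c : R) : \int[P]_x c = c.
Proof.
rewrite Rintegral_cst// -[RHS]mulr1; congr (_ * _).
by rewrite -[RHS]/(fine 1%E); congr fine; exact: probability_setT.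
Qed.

Lemma bounded_expectation_sum I (r : seq I) (F : I -> T -> R) :
  (forall i, bounded_measurable (F i)) ->
  \int[P]_x (\sum_(i <- r) F i x) = \sum_(i <- r) \int[P]_x F i x.
Proof.
move=> bF; elim: r => [|i r IH].
  by rewrite big_nil; under eq_Rintegral do rewrite big_nil; rewrite expectation_cstr.
rewrite big_cons -IH -bounded_expectationD//.
  by under eq_Rintegral do rewrite big_cons.
exact: bounded_measurable_sum.
Qed.

Lemma le_bounded_expectation f g : bounded_measurable f -> bounded_measurable g ->
  (forall x, f x <= g x) -> \int[P]_x f x <= \int[P]_x g x.
Proof. by move=> *; apply: le_Rintegral => //; exact: bounded_measurable_integrable. Qed.

Lemma ae_eq_expectation f g : bounded_measurable f -> bounded_measurable g ->
  {ae P, forall x, f x = g x} -> \int[P]_x f x = \int[P]_x g x.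
Proof.
move=> [mf _] [mg _] fg; congr fine; apply: ae_eq_integral => //.
- exact/measurable_EFinP.
- exact/measurable_EFinP.
by apply: filterS fg => x fgx _ /=; rewrite fgx.
Qed.

Lemma expectation_sqr_gt0 f : bounded_measurable f ->
  {ae P, forall x, f x != 0} -> 0 < \int[P]_x (f x * f x).
Proof.
move=> bf f0; have bff := bounded_measurableM bf bf.
rewrite lt_neqAle Rintegral_ge0 => [|x _]; last by rewrite -expr2 sqr_ge0.
rewrite andbT; apply/negP => /eqP If0.
have : (\int[P]_x `|(f x * f x)%:E| = 0)%E.
  rewrite -[RHS]/(0%:E) If0 /Rintegral fineK; last first.
    exact: integrable_fin_num (bounded_measurable_integrable bff).
  by apply: eq_integral => x _; rewrite gee0_abs// lee_fin -expr2 sqr_ge0.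
have mff : measurable_fun setT (EFin \o (fun x => f x * f x)).
  by apply/measurable_EFinP; case: bff.
move/(ae_eq_integral_abs P measurableT mff) => ff0.
have : {ae P, forall x : T, False}.
  apply: filterS2 f0 ff0 => x fx /(_ I) [] /eqP.
  by rewrite mulf_eq0 orbb (negbTE fx).
move=> [A [_ PA AT]]; have A1 : A = setT.
  by apply/seteqP; split => // x _; apply: AT => /=; exact.
have : P A = 1%E by rewrite A1; exact: probability_setT.
by rewrite [P A]PA => /eqP; rewrite eq_sym onee_eq0.
Qed.

End BoundedExpectation.

Lemma eq_law_expectation d1 d2 d' (T1 : measurableType d1)
    (T2 : measurableType d2) (E : measurableType d') (R : realType)
    (P1 : probability T1 R) (P2 : probability T2 R)
    (X1 : {RV P1 >-> E}) (X2 : {RV P2 >-> E}) (f : E -> R) :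
  same_law X1 X2 -> bounded_measurable f ->
  \int[P1]_w f (X1 w) = \int[P2]_w f (X2 w).
Proof.
move=> law bf; have [mf _] := bf; congr fine.
have bi d (T : measurableType d) (P : probability T R) (X : {RV P >-> E}) :
    (\int[P]_w (f (X w))%:E = \int[distribution P X]_y (f y)%:E)%E.
  rewrite integral_distribution//; first exact/measurable_EFinP.
  apply: (@bounded_measurable_integrable _ _ _ _ (f \o X)).
  exact: bounded_measurable_comp.
by rewrite !bi; apply: eq_measure_integral => A mA _; exact: law.
Qed.

(** Independence makes the joint law of the pair the product of its marginals,
    to which Fubini's theorem applies. *)
Lemma independent_expectationM d d' (T : measurableType d) (E : measurableType d')
    (R : realType) (P : probability T R) (X Y : {RV P >-> E}) (f g : E -> R) :
  independent_pair X Y -> bounded_measurable f -> bounded_measurable g ->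
  \int[P]_w (f (X w) * g (Y w)) = \int[P]_w f (X w) * \int[P]_w g (Y w).
Proof.
move=> XY bf bg; have [mf _] := bf; have [mg _] := bg.
have bfX := bounded_measurable_comp (measurable_funPT X) bf.
have bgY := bounded_measurable_comp (measurable_funPT Y) bg.
pose h (z : E * E) := f z.1 * g z.2.
have bh : bounded_measurable h.
  by apply: bounded_measurableM;
    [exact: (bounded_measurable_comp measurable_fst)
    |exact: (bounded_measurable_comp measurable_snd)].
have mZ : measurable_fun setT (fun w => (X w, Y w)).
  exact: measurable_fun_pair.
pose Z : {RV P >-> (E * E)%type} := mfun_Sub (mem_set mZ).
pose m1 := distribution P X; pose m2 := distribution P Y.
have hZ : (\int[P]_w (h (Z w))%:E = \int[m1 \x m2]_z (h z)%:E)%E.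
  transitivity (\int[distribution P Z]_z (h z)%:E)%E.
    rewrite integral_distribution//; first by apply/measurable_EFinP; case: bh.
    apply: (@bounded_measurable_integrable _ _ _ _ (h \o Z)).
    exact: bounded_measurable_comp.
  apply: eq_measure_integral => A mA _; apply/esym.
  by apply: product_measure_unique => // B C mB mC; exact: XY.
have hE : (\int[m1 \x m2]_z (h z)%:E =
    \int[m1]_x ((f x)%:E * \int[m2]_y (g y)%:E))%E.
  rewrite -integral12_prod_meas1; last first.
    have [mh [M hM]] := bh; apply: measurable_bounded_integrable => //.
      have PT : ((m1 \x m2) (setT `*` setT) = m1 setT * m2 setT)%E.
        exact: product_measure1E.
      rewrite setXTT in PT.
      by rewrite [ltLHS]PT -ge0_fin_numE ?fin_numM// ?fin_num_measure// mule_ge0.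
    exists M; split; rewrite ?num_real// => x Mx y _ /=.
    by rewrite (le_trans (hM _)) ?ltW.
  apply: eq_integral => x _; rewrite /fubini_F /h /=.
  under eq_integral do rewrite EFinM.
  by rewrite integralZl//; exact: bounded_measurable_integrable.
have gfin : (\int[m2]_y (g y)%:E)%E \is a fin_num.
  exact: integrable_fin_num (bounded_measurable_integrable _ bg).
have ffin : (\int[m1]_y (f y)%:E)%E \is a fin_num.
  exact: integrable_fin_num (bounded_measurable_integrable _ bf).
rewrite /Rintegral [X in fine X]hZ hE -(fineK gfin) integralZr//; last first.
  exact: bounded_measurable_integrable.
rewrite fineK// fineM//; congr (fine _ * fine _).
- rewrite integral_distribution//; first exact/measurable_EFinP.
  exact: (@bounded_measurable_integrable _ _ _ _ (f \o X)).
- rewrite integral_distribution//; first exact/measurable_EFinP.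
  exact: (@bounded_measurable_integrable _ _ _ _ (g \o Y)).
Qed.

(** * The weak law of large numbers *)

Section WeakLaw.
Context d (T : measurableType d) (R : realType) (P : probability T R).

Lemma measurable_ge (f : T -> R) e :
  measurable_fun setT f -> measurable [set x | e <= f x].
Proof.
move=> mf; have -> : [set x | e <= f x] = f @^-1` `[e, +oo[.
  by apply/seteqP; split => x; rewrite /= in_itv/= andbT.
by rewrite -[X in measurable X]setTI; exact: mf.
Qed.

Lemma bounded_markov (f : T -> R) e : bounded_measurable f ->
  (forall x, 0 <= f x) -> 0 < e ->
  fine (P [set x | e <= f x]) <= e^-1 * \int[P]_x f x.
Proof.
move=> bf f0 e0; have [mf _] := bf; set A := [set x | _].
have mA : measurable A by exact: measurable_ge.
have bA : bounded_measurable (\1_A : T -> R).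
  split; first exact: measurable_indic.
  by exists 1 => x; rewrite indicE; case: (_ \in _); rewrite ?normr1 ?normr0.
have -> : fine (P A) = \int[P]_x \1_A x.
  by congr fine; rewrite integral_indic// setIT.
rewrite ler_pdivlMl// -bounded_expectationZ//; apply: le_bounded_expectation => //.
  by apply: bounded_measurableM => //; exact: bounded_measurable_cst.
move=> x; rewrite indicE; case: (boolP (x \in A)) => [/set_mem|_].
  by rewrite mulr1.
by rewrite mulr0.
Qed.

Lemma mutually_independent_pair d' (E : measurableType d')
    (X : nat -> {RV P >-> E}) i j :
  mutually_independent X -> i != j -> independent_pair (X i) (X j).
Proof.
move=> indX ij A B mA mB.
pose F k := if k == i then A else B.
have Fi : F i = A by rewrite /F eqxx.
have Fj : F j = B by rewrite /F eq_sym (negbTE ij).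
have mF k : measurable (F k) by rewrite /F; case: ifP.
have := indX [fset i; j]%fset F mF.
rewrite big_fsetU1 ?inE//= big_seq_fset1 Fi Fj => <-; congr (P _).
rewrite eqEsubset; split => [w [Aw Bw] k /=|w Fw].
  by rewrite !inE => /orP[]/eqP ->; rewrite ?Fi ?Fj.
split; [have := Fw i|have := Fw j]; rewrite ?Fi ?Fj; apply;
  by rewrite /= !inE eqxx ?orbT.
Qed.

Lemma measurable_deviation d' (E : measurableType d')
    (X : nat -> {RV P >-> E}) (f : E -> R) m e n : bounded_measurable f ->
  measurable [set w | e <= `|n%:R^-1 * (\sum_(i < n) f (X i w)) - m|].
Proof.
move=> bf; apply/measurable_ge/measurableT_comp => //.
apply: (proj1 (bounded_measurableB (bounded_measurableM _ _) _)).
- exact: bounded_measurable_cst.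
- apply: (@bounded_measurable_sum _ _ _ _ _ (fun i : 'I_n => f \o X i)) => i.
  exact: bounded_measurable_comp.
- exact: bounded_measurable_cst.
Qed.

(** For centred pairwise uncorrelated variables bounded by [K], the second
    moment of a sum of [n] terms is at most [n * K ^ 2]; Markov's inequality for
    the square of the sum then bounds the probability by a multiple of [1 / n]. *)
Lemma weak_law_of_large_numbers d' (E : measurableType d')
    (X : nat -> {RV P >-> E}) (f : E -> R) m :
  mutually_independent X -> bounded_measurable f ->
  (forall i, \int[P]_w f (X i w) = m) ->
  forall e, 0 < e ->
  P [set w | e <= `|n%:R^-1 * (\sum_(i < n) f (X i w)) - m|] @[n --> \oo] --> 0%E.
Proof.
move=> indX bf Ef e e0.
pose g y := f y - m.
have bg : bounded_measurable g.
  by apply: bounded_measurableB => //; exact: bounded_measurable_cst.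
have bgX i : bounded_measurable (g \o X i) by exact: bounded_measurable_comp.
have Eg i : \int[P]_w g (X i w) = 0.
  rewrite bounded_expectationB ?expectation_cstr ?Ef ?subrr//.
    exact: (bounded_measurable_comp (measurable_funPT (X i)) bf).
  exact: bounded_measurable_cst.
have [_ [K gK]] := bg.
have K0 : 0 <= K by apply: le_trans (gK point).
have Egg i j : \int[P]_w (g (X i w) * g (X j w)) <= if i == j then K ^+ 2 else 0.
  case: eqVneq => [->|ij]; last first.
    by rewrite independent_expectationM ?Eg ?mulr0//; exact: mutually_independent_pair.
  rewrite -[leRHS](expectation_cstr P); apply: le_bounded_expectation.
  - exact: (bounded_measurableM (bgX j) (bgX j)).
  - exact: bounded_measurable_cst.
  by move=> w; rewrite -expr2 -(real_normK (num_real _)) ler_sqr ?nnegrE.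
pose S n w := \sum_(i < n) g (X i w).
have bS n : bounded_measurable (S n).
  by apply: (@bounded_measurable_sum _ _ _ _ _ (fun i : 'I_n => g \o X i)).
have ESS n : \int[P]_w (S n w * S n w) <= n%:R * K ^+ 2.
  under eq_Rintegral do rewrite /S mulr_suml.
  rewrite bounded_expectation_sum => [|i]; last first.
    exact: (bounded_measurableM (bgX i) (bS n)).
  rewrite -[X in X%:R]card_ord mulr_natl -sumr_const ler_sum// => i _.
  under eq_Rintegral do rewrite mulr_sumr.
  rewrite bounded_expectation_sum => [|j]; last first.
    exact: (bounded_measurableM (bgX i) (bgX j)).
  apply: le_trans (ler_sum _ (fun (j : 'I_n) _ => Egg i j)) _.
  by rewrite -big_mkcond/= (eq_bigl (pred1 i)) ?big_pred1_eq// => j; rewrite eq_sym.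
have PA n : (0 < n)%N ->
    fine (P [set w | e <= `|n%:R^-1 * (\sum_(i < n) f (X i w)) - m|]) <=
    (K ^+ 2 / e ^+ 2) * n%:R^-1.
  move=> n0; have nR0 : 0 < n%:R :> R by rewrite ltr0n.
  have -> : [set w | e <= `|n%:R^-1 * (\sum_(i < n) f (X i w)) - m|] =
            [set w | (e * n%:R) ^+ 2 <= S n w * S n w].
    have SE w : S n w = n%:R * (n%:R^-1 * (\sum_(i < n) f (X i w)) - m).
      rewrite mulrBr mulVKf ?gt_eqF// /S /g sumrB sumr_const card_ord.
      by rewrite mulr_natl.
    suff eqb w : ((e * n%:R) ^+ 2 <= S n w * S n w) =
        (e <= `|n%:R^-1 * (\sum_(i < n) f (X i w)) - m|).
      by apply/seteqP; split => w /=; rewrite eqb.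
    rewrite -expr2 -(real_normK (num_real (S n w))) ler_sqr ?nnegrE//; last first.
      by rewrite mulr_ge0// ltW.
    by rewrite SE normrM ger0_norm// mulrC ler_pM2l.
  have en0 : 0 < (e * n%:R) ^+ 2 by rewrite exprn_gt0// mulr_gt0.
  apply: le_trans (bounded_markov (bounded_measurableM (bS n) (bS n)) _ en0) _.
    by move=> w; rewrite -expr2 sqr_ge0.
  rewrite ler_pdivrMl//; apply: le_trans (ESS n) _.
  rewrite le_eqVlt; apply/orP; left; apply/eqP; field.
  by rewrite !gt_eqF.
pose c := K ^+ 2 / e ^+ 2.
have c0 : 0 <= c by rewrite divr_ge0// sqr_ge0.
apply: cvg_EFin.
  by near=> n; exact: (fin_num_measure P _ (measurable_deviation X m e n bf)).
apply: (@squeeze_cvgr _ _ _ _ (fun=> 0) (fun n => (c *+ 2) * n.+1%:R^-1)).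
- near=> n; have n0 : (0 < n)%N by near: n; exact: nbhs_infty_gt.
  apply/andP; split; first exact: fine_ge0.
  apply: (le_trans (PA n n0)); rewrite -/c -(mulr_natr c) -[leRHS]mulrA ler_wpM2l//.
  rewrite ler_pdivlMr ?ltr0n// mulrC ler_pdivrMr ?ltr0n//.
  by rewrite -natrM ler_nat mul2n -addnn -addn1 leq_add2l.
- exact: cvg_cst.
- rewrite -[X in _ --> X](mulr0 (c *+ 2)); apply: cvgM; first exact: cvg_cst.
  exact: cvg_harmonic.
Unshelve. all: by end_near.
Qed.
Lemma cvg_measure_bigsetU0 I (r : seq I) (A : I -> nat -> set T) :
  (forall i n, measurable (A i n)) ->
  (forall i, P (A i n) @[n --> \oo] --> 0%E) ->
  P (\big[setU/set0]_(i <- r) A i n) @[n --> \oo] --> 0%E.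
Proof.
move=> mA PA; elim: r => [|i r IH].
  by under eq_fun do rewrite big_nil measure0; exact: cvg_cst.
under eq_fun do rewrite big_cons.
apply: (@squeeze_cvge _ _ _ _ (fun=> 0%E) _
  (fun n => P (A i n) + P (\big[setU/set0]_(j <- r) A j n))%E).
- near=> n; apply/andP; split=> //; apply: measureU2 => //.
  by apply: bigsetU_measurable => j _; exact: mA.
- exact: cvg_cst.
- by rewrite -[X in _ --> X](adde0 0%E); apply: cvgeD => //; exact: PA.
Unshelve. all: by end_near.
Qed.
End WeakLaw.

(** * The uniform distribution on a sphere avoids hyperplanes *)

Section BorelVectors.
Context {R : realType}.

Lemma measurable_mulmx m n (Q : 'M[R]_(m, n)) :
  measurable_fun setT ((fun z => Q *m z) : borel_cV R n -> borel_cV R m).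
Proof.
apply: (@measurability _ _ (borel_cV R n) (borel_cV R m) _ _ open) => //.
move=> _ [A oA <-]; rewrite setTI; apply: sub_sigma_algebra.
have : continuous (fun z : 'cV[R]_n => Q *m z).
  move=> z; apply/(@cvgrPdist_lt _ _ _ (nbhs z)) => e e0.
  have K0 : 0 < n%:R * `|Q| + 1 by rewrite ltr_wpDl// mulr_ge0.
  near=> w; rewrite -mulmxBr (le_lt_trans (ler_mx_normM _ _))// mulrA.
  have : `|z - w| < e / (n%:R * `|Q| + 1).
    by near: w; apply: (@cvgr_dist_lt _ _ _ (nbhs z)) => //; rewrite divr_gt0.
  rewrite ltr_pdivlMr// mulrC; apply: le_lt_trans.
  by rewrite ler_wpM2r// lerDl.
by move/continuousP; exact.
Unshelve. all: by end_near.
Qed.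

Lemma measurable_entry n (i : 'I_n) :
  measurable_fun setT ((fun z => z i 0) : borel_cV R n -> R).
Proof.
apply: (measurability _ (RGenOpens.measurableE R)) => _ [_ [a [b ->] <-]].
rewrite setTI; apply: sub_sigma_algebra.
have : continuous (fun z : 'cV[R]_n => z i 0) by exact: coord_continuous.
by move/continuousP; apply; exact: interval_open.
Qed.

Lemma measurable_sqnorm n :
  measurable_fun setT (@sqnorm R n : borel_cV R n -> R).
Proof.
have -> : @sqnorm R n = fun z => \sum_i z i 0 * z i 0.
  by apply/funext => z; rewrite sqnormE; apply: eq_bigr => i _; rewrite expr2.
by apply: measurable_sum => i; apply: measurable_funM; exact: measurable_entry.
Qed.

Lemma bounded_measurable_dirmx n i j :
  bounded_measurable ((fun z => dirmx z i j) : borel_cV R n -> R).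
Proof.
split; last by exists 1 => z; exact: ler_norm_dirmx.
have -> : (fun z : borel_cV R n => dirmx (z : 'cV[R]_n) i j) =
    fun z : 'cV[R]_n => sqnorm z `^ (-1) * (z i 0 * z j 0).
  by apply/funext => z; rewrite dirmxE powR_inv1// sqnorm_ge0.
apply: measurable_funM.
  apply: (@measurableT_comp _ _ _ _ _ _ (@powR R ^~ (-1))) => //.
  exact: measurable_sqnorm.
by apply: measurable_funM; exact: measurable_entry.
Qed.

End BorelVectors.

(** The two vectors are exchanged by the reflection across the bisecting
    hyperplane, the orthogonal complement of [a - b]. *)
Lemma householder {R : realType} n (a b : 'cV[R]_n) : sqnorm a = sqnorm b ->
  exists2 Q : 'M[R]_n, Q^T *m Q = 1%:M & Q *m a = b.
Proof.
move=> ab; have [<-|] := eqVneq a b.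
  by exists 1%:M; rewrite ?trmx1 mul1mx.
rewrite -subr_eq0; set v := a - b => v0.
have sv0 : sqnorm v != 0 by rewrite sqnorm_eq0.
have abba : a^T *m b = b^T *m a.
  by rewrite [LHS]mx11_scalar -tr_scalar_mx -mx11_scalar trmx_mul trmxK.
have va : v^T *m a = (sqnorm v / 2)%:M.
  rewrite [LHS]mx11_scalar; congr _%:M; rewrite /sqnorm /v linearB/=.
  rewrite !(mulmxBl, mulmxBr) abba !mulmx_trl_col ab.
  by rewrite !mxE /=; field.
have symQ : (1%:M - 2 *: dirmx v)^T = 1%:M - 2 *: dirmx v.
  by rewrite linearB/= trmx1 [(_ *: _)^T]linearZ/= trmx_dirmx.
exists (1%:M - 2 *: dirmx v).
  rewrite symQ mulmxBl mul1mx mulmxBr mulmx1.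
  rewrite -scalemxAl -scalemxAr dirmx_idem; move: (dirmx v) => D.
  by apply/matrixP => i j; rewrite !mxE; ring.
rewrite mulmxBl mul1mx -scalemxAl /dirmx -scalemxAl -mulmxA va mul_mx_scalar.
rewrite !scalerA (_ : _ * _ = 1) ?scale1r; last by field.
by rewrite /v opprB addrC subrK.
Qed.

(** The origin is left out because it lies on every hyperplane, whereas only
    finitely many of the hyperplanes used below pass through a nonzero point. *)
Definition punctured_hyperplane {R : realType} k (a : 'cV[R]_k) :=
  [set z : borel_cV R k |
    (a^T *m (z : 'cV[R]_k)) 0 0 = 0 /\ (z : 'cV[R]_k) != 0].

Section UniformSphere.
Context {R : realType} d (T : measurableType d) (P : probability T R) (k : nat).
Variable u : {RV P >-> borel_cV R k}.
Hypothesis unif_u : uniform_on_sphere u.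

Lemma uniform_expectation_orth (Q : 'M[R]_k) (f : borel_cV R k -> R) :
  Q^T *m Q = 1%:M -> bounded_measurable f ->
  \int[P]_w f (Q *m (u w : 'cV[R]_k)) = \int[P]_w f (u w).
Proof.
move=> QQ bf.
have mQu : measurable_fun setT
    ((fun w => Q *m (u w : 'cV[R]_k)) : T -> borel_cV R k).
  exact: (measurableT_comp (measurable_mulmx Q) (measurable_funPT u)).
pose Qu : {RV P >-> borel_cV R k} := mfun_Sub (mem_set mQu).
apply: (@eq_law_expectation _ _ _ _ _ _ _ _ _ Qu u) => // A mA.
exact: (unif_u.2 Q QQ A mA).
Qed.

Lemma measurable_punctured_hyperplane (a : 'cV[R]_k) :
  measurable (punctured_hyperplane a).
Proof.
have -> : punctured_hyperplane a =
    (fun z : borel_cV R k => (a^T *m (z : 'cV[R]_k)) 0 0) @^-1` [set 0] `&`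
    ((@sqnorm R k) @^-1` (~` [set 0])).
  apply/seteqP; split => z [z1 z2]; split => //; [apply/eqP|].
    by rewrite sqnorm_eq0.
  by move/eqP: z2; rewrite sqnorm_eq0.
apply: measurableI; rewrite -[X in measurable X]setTI.
  apply: (measurableT_comp (measurable_entry 0) (measurable_mulmx a^T)) => //.
apply: measurable_sqnorm => //; exact: measurableC.
Qed.

Lemma uniform_hyperplane_prob_eq (a b : 'cV[R]_k) : sqnorm a = sqnorm b ->
  P (u @^-1` punctured_hyperplane a) = P (u @^-1` punctured_hyperplane b).
Proof.
move=> /householder[Q QQ <-].
have QQ' : Q^T^T *m Q^T = 1%:M by rewrite trmxK; exact: mulmx1C.
rewrite -(unif_u.2 Q^T QQ' _ (measurable_punctured_hyperplane a)).
congr (P _); apply/seteqP; split => w [];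
  rewrite /= /punctured_hyperplane /= trmx_mul !mulmxA => h1 h2; split => //.
  by apply: contra_neq h2 => ->; rewrite mulmx0.
apply: contra_neq h2 => /(congr1 (mulmx Q)).
by rewrite mulmxA mulmx0 (mulmx1C QQ) mul1mx.
Qed.

Lemma punctured_hyperplaneZ c (a : 'cV[R]_k) :
  c != 0 -> punctured_hyperplane (c *: a) = punctured_hyperplane a.
Proof.
move=> c0; have cE z : ((c *: a)^T *m z) 0 0 = c * (a^T *m z) 0 0.
  by rewrite linearZ/= -scalemxAl mxE.
apply/seteqP; split => z []; rewrite /punctured_hyperplane /= ?cE => h h'; split => //.
  by move/eqP: h; rewrite mulf_eq0 (negbTE c0) => /eqP.
by rewrite h mulr0.
Qed.

(** The scalar products of [z] with the points of the moment curve are the values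
    of the polynomial with coefficients [z], of degree less than [k]. *)
Lemma moment_curve_orth_le (z : 'cV[R]_k) M : z != 0 ->
  (\sum_(t < M) (((\col_i t%:R ^+ i)^T *m z) 0%R 0%R == 0%R) <= k)%N.
Proof.
move=> z0; pose p := \poly_(i < k) (if insub i is Some j then z j 0 else 0).
have pE t : (((\col_i t%:R ^+ i)^T *m z) 0 0 == 0) = root p t%:R.
  rewrite /root horner_poly mxE.
  congr (_ == 0); apply: eq_bigr => i _.
  by rewrite valK !mxE mulrC.
have p0 : p != 0.
  apply: contra_neq z0 => pz; apply/colP => i; rewrite mxE.
  by have /polyP/(_ i) := pz; rewrite coef_poly ltn_ord valK coef0.
pose rs : seq R := [seq t%:R | t <- iota 0 M & root p t%:R].
have urs : uniq rs.
  rewrite map_inj_uniq ?filter_uniq ?iota_uniq// => i j /eqP.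
  by rewrite eqr_nat => /eqP.
have ars : all (root p) rs.
  by apply/allP => _ /mapP[t + ->]; rewrite mem_filter => /andP[].
apply: (@leq_trans (size rs)); last first.
  by rewrite -ltnS; 
    apply: leq_trans (max_poly_roots p0 ars urs) _; rewrite ltnW// ltnS size_poly.
rewrite size_map size_filter -sum1_count -[X in iota 0 X]subn0 big_mkord.
rewrite [leqRHS]big_mkcond /=; by apply: leq_sum => i _; rewrite pE; case: root.
Qed.

(** By invariance all hyperplanes have the same probability; a point of the
    sphere lies on at most [k] of the hyperplanes orthogonal to the moment
    curve, of which there are infinitely many. *)
Lemma uniform_hyperplane_null (a : 'cV[R]_k) : a != 0 ->
  {ae P, forall w, (a^T *m (u w : 'cV[R]_k)) 0 0 != 0}.
Proof.
move=> a0.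
have k0 : (0 < k)%N.
  by rewrite lt0n; apply: contra_neq a0 => k0; apply/colP => -[i ik];
    exfalso; rewrite k0 in ik.
(* The moment curve: any k of these vectors are linearly independent. *)
pose m t : 'cV[R]_k := \col_i t%:R ^+ i.
have m0 t : m t != 0.
  apply/eqP => /colP/(_ (Ordinal k0)); rewrite !mxE expr0 => /eqP.
  by rewrite oner_eq0.
have sq_gt0 b : b != 0 -> 0 < sqnorm b.
  by move=> b0; rewrite lt0r sqnorm_eq0 b0 sqnorm_ge0.
pose q := fine (P (u @^-1` punctured_hyperplane a)).
have mpre b : measurable (u @^-1` punctured_hyperplane b).
  by rewrite -[X in measurable X]setTI; apply: (measurable_funPT u) => //;
    exact: measurable_punctured_hyperplane.
have qE t : fine (P (u @^-1` punctured_hyperplane (m t))) = q.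
  pose c := Num.sqrt (sqnorm a / sqnorm (m t)).
  have c0 : 0 < c by rewrite sqrtr_gt0 divr_gt0 ?sq_gt0.
  rewrite /q -(@punctured_hyperplaneZ c (m t)) ?gt_eqF//.
  congr fine; apply: uniform_hyperplane_prob_eq.
  by rewrite sqnormZ sqr_sqrtr ?divr_ge0 ?sqnorm_ge0// divfK// gt_eqF// sq_gt0.
have qM M : M%:R * q <= k%:R.
  pose F (t : 'I_M) w : R := \1_(u @^-1` punctured_hyperplane (m t)) w.
  have bF t : bounded_measurable (F t).
    split; first exact: measurable_indic.
    by exists 1 => w; rewrite /F indicE; case: (_ \in _); rewrite ?normr1 ?normr0.
  have EF t : \int[P]_w F t w = q.
    by rewrite -(qE t); congr fine; rewrite /F integral_indic ?setIT.
  rewrite -[X in X%:R * _]card_ord mulr_natl -sumr_const.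
  under eq_bigr => t _ do rewrite -(EF t).
  rewrite -bounded_expectation_sum// -[leRHS](expectation_cstr P).
  apply: le_bounded_expectation.
  - exact: bounded_measurable_sum.
  - exact: bounded_measurable_cst.
  move=> w; have [uw0|uw0] := eqVneq (u w : 'cV[R]_k) 0.
    rewrite big1 // => t _; rewrite /F indicE memNset// /punctured_hyperplane /= uw0 => -[_].
    by rewrite eqxx.
  apply: (@le_trans _ _
    (\sum_(t < M) (((m t)^T *m (u w : 'cV[R]_k)) 0%R 0%R == 0%R))%N%:R); last first.
    by rewrite ler_nat; exact: moment_curve_orth_le.
  rewrite natr_sum ler_sum// => t _; rewrite /F indicE ler_nat.
  case: (boolP (w \in _)) => // /set_mem[h _].
  by rewrite h eqxx.
have q0 : q = 0.
  apply/eqP; rewrite eq_le fine_ge0//andbT leNgt; apply/negP => qpos.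
  have := archi_boundP (divr_ge0 (ler0n R k) (ltW qpos)).
  by rewrite ltr_pdivrMr// ltNge qM.
have Pq : P (u @^-1` punctured_hyperplane a) = 0%E.
  by rewrite -(fineK (fin_num_measure P _ (mpre a))) -/q q0.
have nH : {ae P, forall w, ~ punctured_hyperplane a (u w)}.
  by exists (u @^-1` punctured_hyperplane a); split => // w /contrapT.
apply: filterS2 nH unif_u.1 => w nHw uw1; apply/eqP => h; apply: nHw; split => //.
by rewrite -sqnorm_eq0 /sqnorm uw1 oner_eq0.
Qed.

End UniformSphere.

(** * Moments of a projected uniform direction *)

Section SignFlipSwap.
Context {R : realType} (p : nat).

Definition signflip (a : 'I_p) : 'M[R]_p :=
  diag_mx (\row_i (if i == a then -1 else 1)).

Lemma signflip_orth a : (signflip a)^T *m signflip a = 1%:M.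
Proof.
rewrite tr_diag_mx mulmx_diag; apply/matrixP => i j; rewrite !mxE.
by case: (i == a); rewrite ?mulrNN mulr1.
Qed.

Lemma dirmx_signflip a (z : 'cV[R]_p) i j :
  dirmx (signflip a *m z) i j =
  (if i == a then -1 else 1) * (if j == a then -1 else 1) * dirmx z i j.
Proof.
rewrite dirmx_orth ?signflip_orth// tr_diag_mx mul_mx_diag mul_diag_mx !mxE.
by rewrite mulrAC.
Qed.

Lemma swap_orth (a b : 'I_p) :
  (perm_mx (tperm a b) : 'M[R]_p)^T *m perm_mx (tperm a b) = 1%:M.
Proof. by rewrite tr_perm_mx -perm_mxM mulVg perm_mx1. Qed.

Lemma dirmx_swap (a b : 'I_p) (z : 'cV[R]_p) i j :
  dirmx (perm_mx (tperm a b) *m z) i j = dirmx z (tperm a b i) (tperm a b j).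
Proof.
rewrite dirmx_orth ?swap_orth// -row_permE tr_perm_mx -col_permE !mxE.
by [].
Qed.

End SignFlipSwap.

Section ProjectedMoments.
Context {R : realType} d (T : measurableType d) (P : probability T R).
Context (k p : nat) (u : {RV P >-> borel_cV R k}).
Hypothesis unif_u : uniform_on_sphere u.
Variable W : 'M[R]_(p, k).
Hypothesis WWT : W *m W^T = 1%:M.

Let y w : 'M[R]_p := dirmx (W *m (u w : 'cV[R]_k)).

Lemma bounded_measurable_projdir i j : bounded_measurable (fun w => y w i j).
Proof.
apply: (bounded_measurable_comp _ (bounded_measurable_dirmx i j)).
exact: (measurableT_comp (measurable_mulmx W) (measurable_funPT u)).
Qed.

(** An orthogonal map [O] of the small space is induced by the orthogonal map
    of the large one that acts as [O] on the row space of [W] and trivially on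
    its orthogonal complement. *)
Lemma projdir_invariant (O : 'M[R]_p) (f : 'M[R]_p -> R) :
  O^T *m O = 1%:M ->
  bounded_measurable ((fun z => f (dirmx z)) : borel_cV R p -> R) ->
  \int[P]_w f (y w) = \int[P]_w f (dirmx (O *m (W *m (u w : 'cV[R]_k)))).
Proof.
move=> OO bf; pose E := 1%:M - W^T *m W; pose Q := W^T *m O *m W + E.
have WE : W *m E = 0 by rewrite mulmxBr mulmx1 mulmxA WWT mul1mx subrr.
have ET : E^T = E by rewrite linearB/= trmx1 trmx_mul trmxK.
have EW : E *m W^T = 0 by rewrite -[E]ET -trmx_mul WE trmx0.
have EE : E *m E = E by rewrite {1}/E mulmxBl mul1mx -mulmxA WE mulmx0 subr0.
have WQ : W *m Q = O *m W by rewrite mulmxDr WE !mulmxA WWT mul1mx addr0.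
have QQ : Q^T *m Q = 1%:M.
  have -> : Q^T = W^T *m O^T *m W + E.
    by rewrite linearD/= ET !trmx_mul trmxK mulmxA.
  rewrite mulmxDl -mulmxA WQ mulmxA -[_ *m O^T *m O]mulmxA OO mulmx1.
  by rewrite mulmxDr !mulmxA EW !mul0mx add0r EE addrC subrK.
have bfW : bounded_measurable
    ((fun z => f (dirmx (W *m (z : 'cV[R]_k)))) : borel_cV R k -> R).
  exact: (bounded_measurable_comp (measurable_mulmx W) bf).
rewrite -(uniform_expectation_orth unif_u QQ bfW).
by apply: eq_Rintegral => w _; rewrite !mulmxA WQ.
Qed.

(** The scalar product of [c] with [W u] is that of [W^T c] with [u], so its
    vanishing puts [u] on a hyperplane. *)
Lemma projdir_linear_neq0 (c : 'cV[R]_p) : c != 0 ->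
  {ae P, forall w, (c^T *m (W *m (u w : 'cV[R]_k))) 0 0 != 0}.
Proof.
move=> c0; have Wc0 : W^T *m c != 0.
  apply: contra_neq c0 => /(congr1 (mulmx W)).
  by rewrite mulmxA WWT mul1mx mulmx0.
apply: filterS (uniform_hyperplane_null unif_u Wc0) => w.
by rewrite trmx_mul trmxK mulmxA.
Qed.

Lemma projdir_entry_neq0 j :
  {ae P, forall w, (W *m (u w : 'cV[R]_k)) j 0 != 0}.
Proof.
have := @projdir_linear_neq0 (delta_mx j 0).
have d0 : (delta_mx j 0 : 'cV[R]_p) != 0.
  apply/eqP => /matrixP/(_ j 0); rewrite !mxE !eqxx => /eqP.
  by rewrite oner_eq0.
move=> /(_ d0); apply: filterS => w.
by rewrite trmx_delta -rowE mxE.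
Qed.

Lemma projdir_odd (O : 'M[R]_p) (f : 'M[R]_p -> R) :
  O^T *m O = 1%:M ->
  bounded_measurable ((fun z => f (dirmx z)) : borel_cV R p -> R) ->
  (forall z : 'cV[R]_p, f (dirmx (O *m z)) = - f (dirmx z)) ->
  \int[P]_w f (y w) = 0.
Proof.
move=> OO bf fN; have := projdir_invariant OO bf.
under [X in _ = X -> _]eq_Rintegral do rewrite fN -mulN1r.
rewrite bounded_expectationZ; last first.
  apply: (bounded_measurable_comp _ bf).
  exact: (measurableT_comp (measurable_mulmx W) (measurable_funPT u)).
by rewrite -/(y _) mulN1r => /eqP; rewrite -addr_eq0 -mulr2n mulrn_eq0/= => /eqP.
Qed.

(** Sign flips kill the entries off the diagonal and swaps make the diagonal
    ones equal; the trace is almost surely [1]. *)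
Lemma projdir_mean i j : (0 < p)%N ->
  \int[P]_w y w i j = if i == j then p%:R^-1 else 0.
Proof.
move=> p0; case: eqVneq => [<-{j}|ij]; last first.
  apply: (projdir_odd (O := signflip i) (f := fun M => M i j)).
  - exact: signflip_orth.
  - exact: bounded_measurable_dirmx.
  move=> z; rewrite dirmx_signflip eqxx eq_sym (negbTE ij) mulr1.
  by rewrite mulN1r.
have same j : \int[P]_w y w j j = \int[P]_w y w i i.
  have := @projdir_invariant _ (fun M => M i i) (swap_orth i j)
    (bounded_measurable_dirmx i i).
  move=> ->; apply: eq_Rintegral => w _.
  by rewrite dirmx_swap tpermL.
have tr1 : \sum_j \int[P]_w y w j j = 1.
  rewrite -bounded_expectation_sum; last first.
    by move=> j; exact: bounded_measurable_projdir.
  rewrite -[RHS](expectation_cstr P); apply: ae_eq_expectation.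
  - by apply: bounded_measurable_sum => j; exact: bounded_measurable_projdir.
  - exact: bounded_measurable_cst.
  apply: filterS (projdir_entry_neq0 i) => w z0; apply: mxtrace_dirmx.
  by apply: contra_neq z0 => ->; rewrite mxE.
move: tr1; rewrite (eq_bigr _ (fun j _ => same j)) sumr_const card_ord => h.
by apply: (mulfI (x := p%:R));
  rewrite ?pnatr_eq0 -?lt0n// mulr_natl h divff// pnatr_eq0 -lt0n.
Qed.

Let bdd i j := @bounded_measurable_dirmx R p i j.

(** Flipping the sign of a coordinate that occurs an odd number of times among
    the four indices changes the sign of the integrand. *)
Lemma projdir_offdiag_moment j m i l : j != m ->
  \int[P]_w (y w j m * y w i l) =
  if (i == j) && (l == m) || (i == m) && (l == j)
  then \int[P]_w (y w j m * y w j m) else 0.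
Proof.
move=> jk; case: ifP => [/orP[/andP[/eqP-> /eqP->//]|/andP[/eqP-> /eqP->]]|no].
  apply: eq_Rintegral => w _; have -> // : y w m j = y w j m.
  by have /matrixP/(_ m j) := trmx_dirmx (W *m (u w : 'cV[R]_k)); rewrite mxE => <-.
have odd a : (j == a) (+) (m == a) (+) (i == a) (+) (l == a) ->
    \int[P]_w (y w j m * y w i l) = 0.
  move=> odd; apply: (projdir_odd (O := signflip a) (f := fun M => M j m * M i l)).
  - exact: signflip_orth.
  - exact: (bounded_measurableM (bdd j m) (bdd i l)).
  move=> z; rewrite !dirmx_signflip; move: odd.
  by do 4 case: (_ == a) => //=; rewrite ?(mulrN, mulNr, mulr1, mul1r, opprK).
have kj : m != j by rewrite eq_sym.
have [il|il] := eqVneq i l.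
  by apply: (odd j); rewrite il eqxx (negbTE kj) /=; case: (l == j).
have li : l != i by rewrite eq_sym.
have [ij|ij] := eqVneq i j.
  apply: (odd l); move: no; rewrite ij eqxx /= -ij (negbTE il) eqxx/=.
  by rewrite ij (negbTE jk) /= orbF [m == l]eq_sym => ->.
have [ik|ik] := eqVneq i m.
  apply: (odd l); move: no; rewrite ik eqxx /= -ik (negbTE il) eqxx/=.
  by rewrite ik (negbTE kj) /= [j == l]eq_sym => ->.
apply: (odd i).
by rewrite [j == i]eq_sym (negbTE ij) [m == i]eq_sym (negbTE ik) eqxx (negbTE li).
Qed.

Lemma projdir_diag_moment j m i l : i != l ->
  \int[P]_w ((y w m m - y w j j) * y w i l) = 0.
Proof.
move=> il.
apply: (projdir_odd (O := signflip i) (f := fun M => (M m m - M j j) * M i l)).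
- exact: signflip_orth.
- exact: (bounded_measurableM (bounded_measurableB (bdd m m) (bdd j j)) (bdd i l)).
move=> z; rewrite !dirmx_signflip eqxx [l == i]eq_sym (negbTE il).
by do 2 case: (_ == i); rewrite !(mulrNN, mulr1, mul1r) mulN1r mulrN.
Qed.

Lemma projdir_offdiag_moment_gt0 j m : 0 < \int[P]_w (y w j m * y w j m).
Proof.
apply: expectation_sqr_gt0; first exact: bounded_measurable_projdir.
apply: filterS2 (projdir_entry_neq0 j) (projdir_entry_neq0 m) => w zj zk.
rewrite /y dirmxE !mulf_neq0// invr_eq0 sqnorm_eq0.
by apply: contra_neq zj => ->; rewrite mxE.
Qed.

(** The difference of the two integrals is that of a square, which vanishes only
    on the hyperplanes where the two coordinates agree up to sign. *)
Lemma projdir_diag_moment_gt0 j m : j != m ->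
  0 < \int[P]_w ((y w m m - y w j j) * y w m m) -
      \int[P]_w ((y w m m - y w j j) * y w j j).
Proof.
move=> jk; have by_ := bounded_measurable_projdir.
have bB : bounded_measurable (fun w => y w m m - y w j j).
  exact: bounded_measurableB.
rewrite -bounded_expectationB; [|exact: bounded_measurableM..].
under eq_Rintegral do rewrite -mulrBr.
apply: expectation_sqr_gt0 => //.
have lin s : s != 0 -> (delta_mx m 0 + s *: delta_mx j 0 : 'cV[R]_p) != 0.
  move=> s0; apply/eqP => /matrixP/(_ m 0).
  rewrite !mxE !eqxx eq_sym (negbTE jk) mulr0 addr0 => /eqP.
  by rewrite oner_eq0.
have e s z : ((delta_mx m 0 + s *: delta_mx j 0 : 'cV[R]_p)^T *m z) 0 0 =
    z m 0 + s * z j 0.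
  rewrite linearD/= linearZ/= !trmx_delta mulmxDl -scalemxAl -!rowE.
  by rewrite !mxE.
have N1 : - 1 != 0 :> R by rewrite oppr_eq0 oner_eq0.
apply: filterS2 (projdir_linear_neq0 (lin 1 (oner_neq0 _)))
  (projdir_linear_neq0 (lin (-1) N1)) => w.
rewrite !e mul1r mulN1r => z1 z2; rewrite /y !dirmxE -mulrBr -!expr2 subr_sqr.
rewrite !mulf_neq0// invr_eq0 sqnorm_eq0.
by apply: contra_neq z1 => ->; rewrite !mxE addr0.
Qed.

End ProjectedMoments.

(** * Quadratic forms at skew perturbations of a direction *)

Section TraceBounds.
Context {R : realType} (p : nat).
Implicit Types (A D G M X Y : 'M[R]_p) (z : 'cV[R]_p).

Lemma ler_norm_mxtraceM X Y : `|\tr (X *m Y)| <= p%:R * (p%:R * (`|X| * `|Y|)).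
Proof. by rewrite (le_trans (ler_mx_tr _))// ler_wpM2l// ler_mx_normM. Qed.

Lemma ler_mx_norm_congr X Y :
  exists2 K, 0 <= K & forall M, `|X *m M *m Y| <= K * `|M|.
Proof.
exists (p%:R * (p%:R * (`|X| * `|Y|))) => [|M]; first by rewrite !mulr_ge0.
apply: le_trans (ler_mx_normM _ _) _.
apply: (le_trans (ler_wpM2l (ler0n _ _) (ler_wpM2r (normr_ge0 Y) (ler_mx_normM X M)))).
by rewrite le_eqVlt; apply/orP; left; apply/eqP; ring.
Qed.

(** The Loewner constraint evaluated at the vector [(1 + A) z]: a skew-symmetric
    [A] moves [z] orthogonally to itself, so the scalar product of this vector
    with [z] is the squared length of [z]. *)
Lemma skew_test_le D (c : R) z A : psd (D - c *: (z *m z^T)) -> A^T = - A ->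
  c * sqnorm z <= \tr (D *m ((1%:M + A) *m dirmx z *m (1%:M + A)^T)).
Proof.
move=> [_ posD] skewA; have [->|z0] := eqVneq z 0.
  by rewrite dirmx0 !(mulmx0, mul0mx) mxtrace0 /sqnorm mulmx0 mxE mulr0.
have s0 : 0 < sqnorm z by rewrite lt0r sqnorm_eq0 z0 sqnorm_ge0.
pose v := (1%:M + A) *m z.
have zAz : (z^T *m A *m z) 0 0 = 0.
  apply/eqP; rewrite -[_ == 0](mulrn_eq0 _ 2) mulr2n addr_eq0; apply/eqP.
  have -> : - (z^T *m A *m z) 0 0 = (z^T *m A *m z)^T 0 0.
    by rewrite !trmx_mul trmxK skewA mulNmx mulmxN mulmxA [RHS]mxE.
  by rewrite [RHS]mxE.
have zv : z^T *m v = (sqnorm z)%:M.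
  rewrite /v mulmxDl mul1mx mulmxDr [LHS]mx11_scalar mxE mulmxA zAz addr0.
  by rewrite -/(sqnorm z).
have vz : v^T *m z = (sqnorm z)%:M.
  by rewrite -[LHS]trmxK trmx_mul trmxK zv tr_scalar_mx.
have := posD v; rewrite mulmxBr mulmxBl -scalemxAr -scalemxAl.
rewrite [v^T *m (z *m z^T)]mulmxA vz.
rewrite -[_%:M *m z^T *m v]mulmxA zv.
rewrite -scalar_mxM scale_scalar_mx [X in 0 <= X -> _]mxE [(- _%:M) 0 0]mxE.
rewrite [_%:M 0 0]mxE eqxx mulr1n subr_ge0 => vDv.
have -> : (1%:M + A) *m dirmx z *m (1%:M + A)^T = (sqnorm z)^-1 *: (v *m v^T).
  by rewrite /dirmx /v -scalemxAr -scalemxAl trmx_mul !mulmxA.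
rewrite -scalemxAr mxtraceZ mulmxA mxtrace_mul_col mulmxA ler_pdivlMl//.
by rewrite mulrC -mulrA.
Qed.

(** The two linear terms coincide: [D M A] is minus the transpose of [A M D]. *)
Lemma skew_congr_expand D M A (t : R) : D^T = D -> M^T = M -> A^T = - A ->
  \tr (D *m ((1%:M + t *: A) *m M *m (1%:M + t *: A)^T)) =
  \tr (D *m M) + t *+ 2 * \tr (D *m (A *m M)) - t ^+ 2 * \tr (D *m (A *m M *m A)).
Proof.
move=> symD symM skewA.
have -> : (1%:M + t *: A)^T = 1%:M - t *: A.
  by rewrite linearD/= trmx1 linearZ/= skewA scalerN.
have DMA : \tr (D *m (M *m A)) = - \tr (D *m (A *m M)).
  rewrite -mxtrace_tr !trmx_mul symD symM skewA mxtrace_mulC.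
  by rewrite mulNmx mulmxN linearN.
rewrite mulmxDl mul1mx -scalemxAl mulmxBr mulmx1 mulmxDl -!scalemxAr -scalemxAl.
rewrite opprD !mulmxDr !mulmxN -!scalemxAr !mxtraceD !raddfN /= !mxtraceZ.
rewrite ?raddfN /= ?mxtraceZ DMA.
by ring.
Qed.

Definition skew_unit a b : 'M[R]_p := delta_mx a b - delta_mx b a.

Lemma trmx_skew_unit a b : (skew_unit a b)^T = - skew_unit a b.
Proof. by rewrite linearB/= !trmx_delta opprB. Qed.

Lemma ler_norm_skew_unit a b : `|skew_unit a b| <= 1.
Proof.
apply: mx_norm_le => // i j; rewrite !mxE.
by do 2 case: (_ && _); rewrite ?subrr ?subr0 ?sub0r ?normr0 ?normrN ?normr1.
Qed.

Lemma mxtrace_skew_unit D G a b :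
  \tr (D *m (skew_unit a b *m G)) = \sum_i G b i * D i a - \sum_i G a i * D i b.
Proof.
have tr_delta c e : \tr (D *m (delta_mx c e *m G)) = \sum_i G e i * D i c.
  have -> : \sum_i G e i * D i c = (G *m D) e c by rewrite mxE.
  rewrite mulmxA mxtrace_mulC mulmxA -(mul_delta_mx (0 : 'I_1)) mulmxA.
  by rewrite mxtrace_mulC -colE -rowE /mxtrace big_ord1 !mxE.
by rewrite mulmxBl mulmxBr linearB/= !tr_delta.
Qed.

End TraceBounds.

(** * The estimate computed from a whitened sample *)

Section WhitenedEstimate.
Context {R : realType} (p n : nat).
Variables (z : 'I_n -> 'cV[R]_p) (h : 'I_n -> R).

(** The sample spatial sign covariance matrix. *)
Definition mean_dir : 'M[R]_p := n%:R^-1 *: \sum_i dirmx (z i).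
Definition weighted_mean_dir : 'M[R]_p := n%:R^-1 *: \sum_i h i *: dirmx (z i).

Lemma mean_skew_test_le D d A t : D^T = D ->
  (forall i, psd (D - (p%:R^-1 * d i) *: (z i *m (z i)^T))) -> A^T = - A ->
  p%:R^-1 * (n%:R^-1 * \sum_i d i * sqnorm (z i)) <=
  \tr (D *m mean_dir) + t *+ 2 * \tr (D *m (A *m weighted_mean_dir)) -
  t ^+ 2 * (n%:R^-1 * \sum_i h i ^+ 2 * \tr (D *m (A *m dirmx (z i) *m A))).
Proof.
move=> symD posD skewA.
have -> : \tr (D *m mean_dir) = n%:R^-1 * \sum_i \tr (D *m dirmx (z i)).
  by rewrite /mean_dir -scalemxAr mxtraceZ mulmx_sumr raddf_sum.
have -> : \tr (D *m (A *m weighted_mean_dir)) =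
    n%:R^-1 * \sum_i h i * \tr (D *m (A *m dirmx (z i))).
  rewrite /weighted_mean_dir -!scalemxAr mxtraceZ !mulmx_sumr raddf_sum /=.
  by congr (_ * _); apply: eq_bigr => i _; rewrite -!scalemxAr mxtraceZ.
rewrite mulrCA [X in _ <= _ + X - _]mulrCA [X in _ <= _ - X]mulrCA -mulrDr -mulrBr.
apply: ler_wpM2l; first by rewrite invr_ge0.
rewrite !mulr_sumr -big_split/= -sumrB ler_sum// => i _.
rewrite mulrA.
have skewhA : (h i *: A)^T = - (h i *: A) by rewrite linearZ/= skewA scalerN.
have skewthA : (t *: (h i *: A))^T = - (t *: (h i *: A)).
  by rewrite linearZ/= skewhA scalerN.
apply: le_trans (skew_test_le (posD i) skewthA) _.
rewrite (skew_congr_expand _ symD (trmx_dirmx _) skewhA).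
rewrite -!scalemxAl -!scalemxAr !mxtraceZ.
by rewrite le_eqVlt; apply/orP; left; apply/eqP; ring.
Qed.

End WhitenedEstimate.

Section CocaNear.
Context {R : realType} (p : nat).
Variables (N : 'M[R]_p -> R) (normN : is_norm N).
Variables (S : set 'M[R]_p) (S_psd : S `<=` [set M | psd M]).
Variables (C0 B : 'M[R]_p) (SC0 : S C0) (trC0 : \tr C0 = 1).
Hypotheses (Bunit : B \in unitmx) (C0B : C0 = B *m B^T) (p_gt0 : (0 < p)%N).

Let V := invmx B.

Let VB : V *m B = 1%:M. Proof. exact: mulVmx. Qed.
Let BV : B *m V = 1%:M. Proof. exact: mulmxV. Qed.
Let VTBT : V^T *m B^T = 1%:M. Proof. by rewrite -trmx_mul BV trmx1. Qed.

Let pR_gt0 : 0 < p%:R :> R. Proof. by rewrite ltr0n. Qed.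

Lemma psd_congr (M X : 'M[R]_p) : psd M -> psd (X *m M *m X^T).
Proof.
move=> [symM posM]; split; first by rewrite !trmx_mul trmxK symM mulmxA.
move=> v; have := posM (X^T *m v).
by rewrite trmx_mul trmxK !mulmxA.
Qed.

(** The matrix is an orthogonal projection, hence of the form [X X^T]. *)
Lemma psd_1Bdirmx (z : 'cV[R]_p) : psd (1%:M - dirmx z).
Proof.
have ST : (1%:M - dirmx z)^T = 1%:M - dirmx z.
  by rewrite linearB/= trmx1 trmx_dirmx.
have -> : 1%:M - dirmx z = (1%:M - dirmx z) *m 1%:M *m (1%:M - dirmx z)^T.
  rewrite ST mulmx1 mulmxBl mul1mx mulmxBr mulmx1 dirmx_idem subrr.
  by rewrite subr0.
apply: psd_congr; split; first by rewrite trmx1.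
by move=> v; rewrite mulmx1; exact: sqnorm_ge0.
Qed.

(** The weights are the largest ones allowed by the true shape matrix. A sample
    at the origin gets weight [p / 0 = 0] and contributes nothing. *)
Lemma coca_reference_feasible n (x : 'I_n -> 'cV[R]_p) :
  coca_feasible S x C0 (fun i => p%:R / sqnorm (V *m x i)).
Proof.
split => // i; last by rewrite divr_ge0// sqnorm_ge0.
rewrite /loewner_ge mulKf ?gt_eqF//.
have {2}-> : x i = B *m (V *m x i) by rewrite mulmxA BV mul1mx.
have {3}-> : x i = B *m (V *m x i) by rewrite mulmxA BV mul1mx.
have -> : C0 - (sqnorm (V *m x i))^-1 *:
    (B *m (V *m x i) *m (B *m (V *m x i))^T) =
    B *m (1%:M - dirmx (V *m x i)) *m B^T.
  rewrite mulmxBr mulmx1 mulmxBl -C0B /dirmx -scalemxAr -scalemxAl.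
  by rewrite [in LHS]trmx_mul !mulmxA.
exact/psd_congr/psd_1Bdirmx.
Qed.

Lemma coca_reference_residual n (x : 'I_n -> 'cV[R]_p) :
  C0 - n%:R^-1 *: (\sum_i (p%:R / sqnorm (V *m x i)) *: (x i *m (x i)^T)) =
  B *m (1%:M - p%:R *: mean_dir (fun i => V *m x i)) *m B^T.
Proof.
rewrite mulmxBr mulmx1 mulmxBl -C0B; congr (_ - _).
rewrite /mean_dir -scalemxAr -scalemxAl -scalemxAr -scalemxAl scalerA mulrC -scalerA.
congr (_ *: _); rewrite mulmx_sumr mulmx_suml scaler_sumr.
apply: eq_bigr => i _.
rewrite /dirmx -scalemxAr -scalemxAl scalerA trmx_mul !mulmxA BV mul1mx.
by rewrite -[_ *m V^T *m B^T]mulmxA VTBT mulmx1.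
Qed.

(** The estimate does at least as well as the true shape matrix, whose residual
    is a congruence of the deviation of the sign covariance from [1 / p]; the
    rest is comparison of norms. *)
Lemma coca_whitened_residual_le : exists2 K, 0 <= K &
  forall n (x : 'I_n -> 'cV[R]_p) C d, coca_solution S N x C d ->
  `|\tr (V *m (C - n%:R^-1 *: \sum_i d i *: (x i *m (x i)^T)) *m V^T)| <=
  K * `|1%:M - p%:R *: mean_dir (fun i => V *m x i)|.
Proof.
have [KV KV0 hV] := ler_mx_norm_congr V V^T.
have [KB KB0 hB] := ler_mx_norm_congr B B^T.
have [K1 K10 h1] := ler_mx_norm_is_norm normN.
have [K2 K20 h2] := let: And3 ND NZ _ := normN in ler_seminorm_mx_norm ND NZ.
exists (p%:R * (KV * (K1 * (K2 * KB)))) => [|n x C d [_ optC]].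
  by rewrite !mulr_ge0.
rewrite (le_trans (ler_mx_tr _))// -!mulrA ler_wpM2l//.
rewrite (le_trans (hV _))// ler_wpM2l// (le_trans (h1 _))// ler_wpM2l//.
have := optC _ _ (coca_reference_feasible x).
rewrite /coca_objective coca_reference_residual => /le_trans; apply.
by rewrite (le_trans (h2 _))// ler_wpM2l// hB.
Qed.

Lemma whitened_sample n (x : 'I_n -> 'cV[R]_p) (d : 'I_n -> R) :
  V *m (n%:R^-1 *: \sum_i d i *: (x i *m (x i)^T)) *m V^T =
  n%:R^-1 *: \sum_i d i *: ((V *m x i) *m (V *m x i)^T).
Proof.
rewrite -scalemxAr -scalemxAl mulmx_sumr mulmx_suml; congr (_ *: _).
by apply: eq_bigr => i _; rewrite -scalemxAr -scalemxAl trmx_mul !mulmxA.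
Qed.

(** Optimality bounds the trace of the whitened residual, and feasibility bounds
    the weights [d i] by quadratic forms at perturbed directions. For an
    unperturbed direction ([s = 0] below) the two bounds agree in the limit, so
    that the term linear in [s] is at most a quadratic one plus the sampling
    error. With an error of order [tau ^+ 2] the choice [s = tau] or [s = - tau]
    leaves a bound of order [tau]. *)
Lemma coca_skew_test : exists2 K, 0 <= K &
  forall n (x : 'I_n -> 'cV[R]_p) C (h : 'I_n -> R) (H : 'M[R]_p) a b tau,
  let z i := V *m x i in
  0 < tau <= 1 -> (0 < n)%N -> coca_estimate S N x C ->
  (forall i, `|h i| <= 2) ->
  `|mean_dir z - p%:R^-1%:M| <= tau ^+ 2 ->
  `|weighted_mean_dir z h - H| <= tau ^+ 2 ->
  `|\tr (V *m C *m V^T *m (skew_unit a b *m H))| <= K * tau.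
Proof.
have [KV KV0 hV] := ler_mx_norm_congr V V^T.
have [K1 K10 h1] := coca_whitened_residual_le.
set P := p%:R : R.
pose K2 := P * (P * KV).
pose K3 := P * (P * (P * (KV * 1))).
pose K4 := 4 * (P * (P * (KV * (P * (P * 1))))).
exists (K1 + K2 + K3 * 2 + K4) => [|n x C h H a b tau z].
  by rewrite !addr_ge0 ?mulr_ge0.
move=> /andP[t0 t1] n0 [d solC] h2 hP hH.
have resid := h1 _ _ _ _ solC.
have [[SC trC feasC d0] optC] := solC.
have psdC : psd C by exact: S_psd.
pose D := V *m C *m V^T.
have symD : D^T = D by case: (psd_congr V psdC).
have nD : `|D| <= KV.
  rewrite (le_trans (hV _))// -[leRHS]mulr1 ler_wpM2l// -trC.
  exact: ler_mx_norm_psd.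
have posD i : psd (D - (P^-1 * d i) *: (z i *m (z i)^T)).
  have := psd_congr V (feasC i); rewrite mulmxBr mulmxBl -scalemxAr -scalemxAl.
  by rewrite /z trmx_mul !mulmxA.
pose A : 'M[R]_p := skew_unit a b.
have nA : `|A| <= 1 by exact: ler_norm_skew_unit.
pose E := \tr (V *m (C - n%:R^-1 *: \sum_i d i *: (x i *m (x i)^T)) *m V^T).
have trE : n%:R^-1 * (\sum_i d i * sqnorm (z i)) = \tr D - E.
  rewrite /E mulmxBr mulmxBl whitened_sample raddfB /= -/D opprB addrC subrK.
  rewrite mxtraceZ raddf_sum /=; congr (_ * _); apply: eq_bigr => i _.
  by rewrite mxtraceZ mxtrace_mul_col.
have nE : `|E| <= K1 * (P * tau ^+ 2).
  rewrite (le_trans resid)// ler_wpM2l//.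
  have -> : 1%:M - P *: mean_dir z = - (P *: (mean_dir z - P^-1%:M)).
    by rewrite scalerBr scale_scalar_mx divff ?gt_eqF// opprB.
  by rewrite normrN normrZ ger0_norm ?ler_wpM2l// ltW.
pose Q := n%:R^-1 * \sum_i h i ^+ 2 * \tr (D *m (A *m dirmx (z i) *m A)).
have nQ : `|Q| <= K4.
  rewrite /Q normrM ger0_norm ?invr_ge0// ler_pdivrMl ?ltr0n//.
  rewrite (le_trans (ler_norm_sum _ _ _))// -[X in X%:R]card_ord mulr_natl.
  rewrite -sumr_const ler_sum// => i _; rewrite normrM /K4 ler_pM//.
    by rewrite normrX (_ : 4 = 2 ^+ 2) ?ler_pXn2r ?nnegrE//; ring.
  rewrite (le_trans (ler_norm_mxtraceM _ _))// !ler_wpM2l// ler_pM//.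
  rewrite (le_trans (ler_mx_normM _ _))// ler_wpM2l//.
  apply: le_trans (ler_pM _ _ (ler_mx_normM _ _) nA) _ => //; rewrite !mulr1.
  rewrite -[leRHS]mulr1 ler_wpM2l// -[leRHS]mulr1 ler_pM//.
  by apply: mx_norm_le => // j l; exact: ler_norm_dirmx.
pose L := \tr (D *m (A *m H)).
pose E2 := \tr (D *m (mean_dir z - P^-1%:M)).
have nE2 : `|E2| <= K2 * tau ^+ 2.
  rewrite (le_trans (ler_norm_mxtraceM _ _))// /K2 -!mulrA !ler_wpM2l//.
  by rewrite ler_pM.
pose E3 := \tr (D *m (A *m (weighted_mean_dir z h - H))).
have nE3 : `|E3| <= K3 * tau ^+ 2.
  rewrite (le_trans (ler_norm_mxtraceM _ _))//.
  have -> : K3 * tau ^+ 2 = P * (P * (KV * (P * (1 * tau ^+ 2)))).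
    by rewrite /K3; ring.
  rewrite !ler_wpM2l// ler_pM//.
  by rewrite (le_trans (ler_mx_normM _ _))// ler_wpM2l// ler_pM.
have main s : - (s *+ 2 * L) <= `|E| / P + E2 + s *+ 2 * E3 - s ^+ 2 * Q.
  have := mean_skew_test_le h s symD posD (trmx_skew_unit a b).
  rewrite trE -/P -/Q.
  have -> : \tr (D *m mean_dir z) = E2 + P^-1 * \tr D.
    by rewrite /E2 mulmxBr mul_mx_scalar raddfB /= mxtraceZ subrK.
  have -> : \tr (D *m (A *m weighted_mean_dir z h)) = E3 + L.
    by rewrite /E3 !mulmxBr raddfB /= subrK.
  have : P^-1 * E <= `|E| / P by rewrite mulrC ler_wpM2r ?invr_ge0// ler_norm.
  by rewrite mulrBr mulrDr; lra.
have E1 : `|E| / P <= K1 * tau ^+ 2.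
  by rewrite ler_pdivrMr// -mulrA [_ * P]mulrC.
have t2 : 0 <= tau ^+ 2 by exact: sqr_ge0.
have K3_ge0 : 0 <= K3 by rewrite !mulr_ge0.
have tE3 : `|tau * E3| <= K3 * tau ^+ 2.
  by rewrite normrM gtr0_norm// -[leRHS]mul1r ler_pM// ltW.
have tQ : `|tau ^+ 2 * Q| <= K4 * tau ^+ 2.
  by rewrite normrM ger0_norm// mulrC ler_wpM2r.
have : `|tau * L| <= (K1 + K2 + K3 * 2 + K4) * tau ^+ 2.
  have := main tau; have := main (- tau); rewrite sqrrN.
  move: nE2 tE3 tQ E1; rewrite !ler_norml.
  by move=> *; apply/andP; split; lra.
by rewrite normrM gtr0_norm// expr2 mulrCA ler_pM2l.
Qed.

(** The whitened estimate is close to a scalar matrix, so the estimate is close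
    to a multiple of [C0]; both traces being [1], this multiple is close to [1]. *)
Lemma near_scalar_near : exists2 K, 0 <= K &
  forall C e, 0 <= e -> \tr C = 1 ->
  (forall a b, a != b -> `|(V *m C *m V^T) a b| <= e) ->
  (forall a b, a != b -> `|(V *m C *m V^T) a a - (V *m C *m V^T) b b| <= e) ->
  `|C - C0| <= K * e.
Proof.
have [KB KB0 hB] := ler_mx_norm_congr B B^T.
exists (KB * (1 + p%:R * `|C0|)) => [|C e e0 trC off diag].
  by rewrite mulr_ge0// addr_ge0// mulr_ge0.
pose D := V *m C *m V^T; pose i0 := Ordinal p_gt0.
pose c := D i0 i0; pose X := D - c%:M.
have nX : `|X| <= e.
  have XE i j : X i j = D i j - c *+ (i == j).
    by rewrite /X; move: (D) => D'; rewrite !mxE.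
  apply: mx_norm_le => // i j; rewrite XE.
  case: eqVneq => [<-|ij]; last by rewrite subr0 off.
  rewrite mulr1n /c; have [->|] := eqVneq i i0; first by rewrite subrr normr0.
  exact: diag.
have CE : C - c *: C0 = B *m X *m B^T.
  rewrite mulmxBr mulmxBl mul_mx_scalar -scalemxAl -C0B /D !mulmxA BV mul1mx.
  by rewrite -mulmxA VTBT mulmx1.
have nBX : `|B *m X *m B^T| <= KB * e.
  by rewrite (le_trans (hB _))// ler_wpM2l.
have c1 : `|1 - c| <= p%:R * (KB * e).
  have -> : 1 - c = \tr (C - c *: C0) by rewrite raddfB /= mxtraceZ trC trC0 mulr1.
  by rewrite CE (le_trans (ler_mx_tr _))// ler_wpM2l.
have -> : C - C0 = B *m X *m B^T - (1 - c) *: C0.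
  by rewrite -CE scalerBl scale1r opprB addrA subrK.
apply: le_trans (ler_normB _ _) _; rewrite normrZ.
have : `|1 - c| * `|C0| <= p%:R * (KB * e) * `|C0| by rewrite ler_wpM2r.
by move: nBX; lra.
Qed.

(** Weights for which the limit of the linear term isolates, up to a positive
    factor, the difference of two diagonal entries of the whitened estimate
    ([true]) or one entry off its diagonal ([false]); see
    [mxtrace_skew_offdiag] and [mxtrace_skew_diag]. *)
Definition direction_test (s : bool) (a b : 'I_p) (M : 'M[R]_p) : R :=
  if s then M a b else M b b - M a a.

Lemma ler_norm_direction_test s a b (z : 'cV[R]_p) :
  `|direction_test s a b (dirmx z)| <= 2.
Proof.
have := ler_norm_dirmx z a b; have := ler_norm_dirmx z a a.
have := ler_norm_dirmx z b b; rewrite /direction_test !ler_norml.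
by case: s => *; lra.
Qed.

Variables (beta : 'I_p -> 'I_p -> R) (H : bool -> 'I_p -> 'I_p -> 'M[R]_p).
Hypothesis beta_gt0 : forall a b, a != b -> 0 < beta a b.
Hypothesis H_offdiag : forall a b i l, a != b -> H true a b i l =
  if (i == a) && (l == b) || (i == b) && (l == a) then beta a b else 0.
Hypothesis H_diag : forall a b i l, a != b -> i != l -> H false a b i l = 0.
Hypothesis H_diag_gt0 : forall a b, a != b ->
  0 < H false a b b b - H false a b a a.

Lemma mxtrace_skew_offdiag (D : 'M[R]_p) a b : a != b ->
  \tr (D *m (skew_unit a b *m H true a b)) = beta a b * (D a a - D b b).
Proof.
move=> ab; rewrite mxtrace_skew_unit.
rewrite (bigD1 a)//= big1 => [|i ia]; last first.
  by rewrite H_offdiag// eqxx (negbTE ia) eq_sym (negbTE ab) mul0r.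
rewrite [X in _ - X](bigD1 b)//= [X in _ - (_ + X)]big1 => [|i ib]; last first.
  by rewrite H_offdiag// eqxx (negbTE ib) (negbTE ab) mul0r.
by rewrite !H_offdiag// !eqxx orbT /= !addr0 mulrBr.
Qed.

Lemma mxtrace_skew_diag (D : 'M[R]_p) a b : D^T = D -> a != b ->
  \tr (D *m (skew_unit a b *m H false a b)) =
  (H false a b b b - H false a b a a) * D a b.
Proof.
move=> symD ab; rewrite mxtrace_skew_unit.
rewrite (bigD1 b)//= big1 => [|i ib]; last by rewrite H_diag ?mul0r// eq_sym.
rewrite [X in _ - X](bigD1 a)//= [X in _ - (_ + X)]big1 => [|i ia]; last first.
  by rewrite H_diag ?mul0r// eq_sym.
by rewrite !addr0 mulrBl -{1}symD mxE.
Qed.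

(** No probability is left here: the estimate is as close to [C0] as desired once
    finitely many sample averages are close enough to their expectations, for
    all sample sizes at once. The matrices [H] stand for the expectations of the
    weighted averages. *)
Lemma coca_near eps : 0 < eps -> exists2 theta, 0 < theta &
  forall n (x : 'I_n -> 'cV[R]_p) C, (0 < n)%N -> coca_estimate S N x C ->
  let z i := V *m x i in
  `|mean_dir z - p%:R^-1%:M| <= theta ->
  (forall s a b, a != b ->
     `|weighted_mean_dir z (fun i => direction_test s a b (dirmx (z i))) - H s a b|
     <= theta) ->
  `|C - C0| < eps.
Proof.
move=> eps0; have [K K0 hK] := coca_skew_test.
have [K' K'0 hK'] := near_scalar_near.
(* A bound for the inverses of the finitely many positive factors. *)
pose L :=
  \sum_a \sum_b (`|beta a b|^-1 + `|H false a b b b - H false a b a a|^-1).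
have term_ge0 a b : 0 <= `|beta a b|^-1 + `|H false a b b b - H false a b a a|^-1.
  by rewrite addr_ge0// invr_ge0.
have leL a b : `|beta a b|^-1 + `|H false a b b b - H false a b a a|^-1 <= L.
  rewrite /L (bigD1 a)//= (bigD1 b)//= -addrA lerDl addr_ge0//.
    by apply: sumr_ge0 => i _.
  by apply: sumr_ge0 => i _; apply: sumr_ge0 => j _.
have L0 : 0 <= L by apply: sumr_ge0 => i _; apply: sumr_ge0 => j _.
pose M := K' * (L * K); have M0 : 0 <= M by rewrite !mulr_ge0.
pose tau := Num.min 1 (eps / (M + 1)).
have M1 : 0 < M + 1 by rewrite ltr_wpDl.
have tau0 : 0 < tau by rewrite lt_min ltr01 divr_gt0.
have Mtau : M * tau < eps.
  apply: (@le_lt_trans _ _ (M * (eps / (M + 1)))).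
    by rewrite ler_wpM2l// ge_min lexx orbT.
  by rewrite mulrA ltr_pdivrMr// mulrDr mulr1 mulrC ltrDl.
exists (tau ^+ 2) => [|n x C n0 est z hP hH]; first by rewrite exprn_gt0.
have [d [[SC trC _ _] _]] := est.
have symD : (V *m C *m V^T)^T = V *m C *m V^T.
  by case: (psd_congr V (S_psd SC)).
have t01 : 0 < tau <= 1 by rewrite tau0 ge_min lexx.
have test s a b : a != b ->
    `|\tr (V *m C *m V^T *m (skew_unit a b *m H s a b))| <= K * tau.
  move=> ab; apply: (hK _ _ _ _ _ a b tau t01 n0 est _ hP (hH s a b ab)).
  by move=> i; exact: ler_norm_direction_test.
have bound g (X : R) : 0 < g -> g^-1 <= L -> `|g * X| <= K * tau ->
    `|X| <= L * K * tau.
  move=> g0 gL; rewrite normrM gtr0_norm// -ler_pdivlMl// => /le_trans; apply.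
  by rewrite -mulrA ler_wpM2r// mulr_ge0// ltW.
have : `|C - C0| <= K' * (L * K * tau).
  apply: hK' => //; first by rewrite !mulr_ge0// ltW.
  - move=> a b ab; apply: (bound _ _ (H_diag_gt0 ab)).
      rewrite -[X in X^-1](gtr0_norm (H_diag_gt0 ab)).
      by rewrite (le_trans _ (leL a b))// lerDr invr_ge0.
    by rewrite -mxtrace_skew_diag// test.
  - move=> a b ab; apply: (bound _ _ (beta_gt0 ab)).
      rewrite -[X in X^-1](gtr0_norm (beta_gt0 ab)).
      by rewrite (le_trans _ (leL a b))// lerDl invr_ge0.
    by rewrite -mxtrace_skew_offdiag// test.
by move=> /le_lt_trans; apply; rewrite -[X in X < _]/(K' * (L * K * tau)) mulrA.
Qed.

End CocaNear.

(** * Consistency *)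

Theorem theorem2 (R : realType) (p : nat)
  (N : 'M[R]_p -> R) (normN : is_norm N)
  (S : set 'M[R]_p) (S_psd : S `<=` [set M | psd M])
  (S_convex : convex_set (S : set (convex_lmodType 'M[R]_p)))
  (Ctrue : 'M[R]_p) (Ctrue_S : S Ctrue) (trCtrue : \tr Ctrue = 1)
  (Ctrue_unit : Ctrue \in unitmx)
  (d0 : measure_display) (T0 : measurableType d0) (P0 : probability T0 R)
  (x : {RV P0 >-> borel_cV R p}) (x_elliptical : elliptical x Ctrue)
  (d : measure_display) (T : measurableType d) (P : probability T R)
  (xs : nat -> {RV P >-> borel_cV R p})
  (xs_indep : mutually_independent xs)
  (xs_law : forall i, same_law (xs i) x)
  (Ccoca : nat -> T -> 'M[R]_p)
  (Ccoca_solution : forall n, (0 < n)%N ->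
     {ae P, forall w, coca_estimate S N (fun i : 'I_n => xs i w) (Ccoca n w)}) :
  cvg_in_probability P Ccoca Ctrue.
Proof.
have p_gt0 : (0 < p)%N.
  rewrite lt0n; apply/negP => /eqP p0; move: trCtrue.
  rewrite /mxtrace big1 => [/eqP|[i ip] _]; first by rewrite eq_sym oner_eq0.
  by exfalso; rewrite p0 in ip.
have [k [Lambda [r [u [unif_u [r_ge0 r_gt0] _ xE CE]]]]] := x_elliptical.
have [||B Bunit CB] := @cholesky _ _ Ctrue.
- by rewrite CE trmx_mul trmxK.
- move=> v v0.
  have -> : (v^T *m Ctrue *m v) 0 0 = sqnorm (Lambda^T *m v).
    by rewrite /sqnorm CE trmx_mul trmxK !mulmxA.
  rewrite lt0r sqnorm_ge0 andbT sqnorm_eq0; apply: contra_neq v0 => Lv.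
  by rewrite -(mulKmx Ctrue_unit v) CE -[Lambda *m _ *m v]mulmxA Lv !mulmx0.
(* Whitening: V x is a positive multiple of W u, and W W^T is the identity. *)
pose V := invmx B; pose W := V *m Lambda.
have WWT : W *m W^T = 1%:M.
  rewrite /W trmx_mul mulmxA -[V *m _ *m _]mulmxA -CE CB mulmxA mulVmx//.
  by rewrite mul1mx -trmx_mul mulVmx// trmx1.
pose y w : 'M[R]_p := dirmx (W *m (u w : 'cV[R]_k)).
(* One index type for all the averages that must converge: None for the entries
   of the sign covariance, Some for its versions weighted by a test. *)
pose wt (o : option (bool * 'I_p * 'I_p)) (M : 'M[R]_p) : R :=
  if o is Some (s, a, b) then direction_test s a b M else 1.
pose F (t : option (bool * 'I_p * 'I_p) * ('I_p * 'I_p)) (M : 'M[R]_p) : R :=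
  wt t.1 M * M t.2.1 t.2.2.
have bw (o : option (bool * 'I_p * 'I_p)) :
    bounded_measurable ((fun z => wt o (dirmx z)) : borel_cV R p -> R).
  case: o => [[[[] a] b]|]; rewrite /wt /direction_test.
  - exact: bounded_measurable_dirmx.
  - by apply: bounded_measurableB; exact: bounded_measurable_dirmx.
  - exact: bounded_measurable_cst.
have bF t : bounded_measurable ((fun z => F t (dirmx z)) : borel_cV R p -> R).
  by apply: bounded_measurableM => //; exact: bounded_measurable_dirmx.
have bFV t : bounded_measurable
    ((fun z => F t (dirmx (V *m (z : 'cV[R]_p)))) : borel_cV R p -> R).
  exact: (bounded_measurable_comp (measurable_mulmx V) (bF t)).
pose m t := \int[P0]_w F t (y w).
(* The projected direction forgets the positive radius. *)
have EF t i : \int[P]_w F t (dirmx (V *m (xs i w : 'cV[R]_p))) = m t.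
  rewrite (eq_law_expectation (xs_law i) (bFV t)).
  apply: ae_eq_expectation.
  - exact: (bounded_measurable_comp (measurable_funPT x) (bFV t)).
  - apply: (bounded_measurable_comp _ (bF t)).
    exact: (measurableT_comp (measurable_mulmx W) (measurable_funPT u)).
  apply: filterS r_gt0 => w rw.
  by rewrite xE -scalemxAr dirmxZ ?gt_eqF// mulmxA.
pose H s a b : 'M[R]_p := \matrix_(i, l) m (Some (s, a, b), (i, l)).
have beta_gt0 a b : a != b -> 0 < \int[P0]_w (y w a b * y w a b).
  by move=> _; exact: projdir_offdiag_moment_gt0.
have H_offdiag a b i l : a != b -> H true a b i l =
    if (i == a) && (l == b) || (i == b) && (l == a)
    then \int[P0]_w (y w a b * y w a b) else 0.
  by move=> ab; rewrite mxE; exact: projdir_offdiag_moment.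
have H_diag a b i l : a != b -> i != l -> H false a b i l = 0.
  by move=> ab il; rewrite mxE; exact: projdir_diag_moment.
have H_diag_gt0 a b : a != b -> 0 < H false a b b b - H false a b a a.
  by move=> ab; rewrite !mxE; exact: projdir_diag_moment_gt0.
move=> eps eps0.
have [theta theta0 near_] := coca_near normN S_psd Ctrue_S trCtrue Bunit CB
  p_gt0 beta_gt0 H_offdiag H_diag H_diag_gt0 eps0.
pose f t (z : borel_cV R p) := F t (dirmx (V *m (z : 'cV[R]_p))).
pose A t n := [set w | theta <= `|n%:R^-1 * (\sum_(i < n) f t (xs i w)) - m t|].
have mA t n : measurable (A t n).
  exact: (measurable_deviation xs (m t) theta n (bFV t)).
have PA : P (\big[setU/set0]_t A t n) @[n --> \oo] --> 0%E.
  apply: cvg_measure_bigsetU0 => // t.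
  exact: (weak_law_of_large_numbers xs_indep (bFV t) (EF t) theta0).
apply: (@squeeze_cvge _ _ _ _ (fun=> 0%E) _
  (fun n => P (\big[setU/set0]_t A t n))) => //; last exact: cvg_cst.
near=> n; have n0 : (0 < n)%N by near: n; exact: nbhs_infty_gt.
rewrite mu_ext_ge0//=.
(* Off a null set, a large error forces one of the averages to deviate. *)
have [Z [mZ PZ hZ]] := Ccoca_solution n n0.
have mU : measurable (\big[setU/set0]_t A t n).
  by apply: bigsetU_measurable => t _; exact: mA.
apply: (@le_trans _ _ (P (Z `|` \big[setU/set0]_t A t n))); last first.
  apply: (le_trans (measureU2 _ mZ mU)); rewrite -[leRHS]add0e.
  by apply: leeD => //; rewrite le_eqVlt; apply/orP; left; apply/eqP.
rewrite -measurable_mu_extE; last exact: measurableU.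
apply: le_mu_ext => w /= Cw; apply: contrapT => /not_orP[nZ nU].
have est : coca_estimate S N (fun i : 'I_n => xs i w) (Ccoca n w).
  by apply: contrapT => h; apply: nZ; exact: hZ.
have dev t : `|n%:R^-1 * (\sum_(i < n) f t (xs i w)) - m t| <= theta.
  apply: ltW; rewrite ltNge; apply/negP => h; apply: nU.
  by rewrite -bigcup_seq; exists t => //=; exact: mem_index_enum.
have := near_ n _ _ n0 est; rewrite -/V => near_n.
suff : `|Ccoca n w - Ctrue| < eps by rewrite ltNge Cw.
apply: near_n => [|s a b ab]; apply: mx_norm_le (ltW theta0) _ => i l.
- have := dev (None, (i, l)); rewrite /m /F /=.
  under [X in _ - X]eq_Rintegral do rewrite mul1r.
  rewrite projdir_mean// /mean_dir !mxE summxE mulrb.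
  by under eq_bigr do rewrite /f /F mul1r.
- have := dev (Some (s, a, b), (i, l)).
  rewrite /weighted_mean_dir !mxE summxE.
  by under [X in _ -> `|_ * X - _| <= _]eq_bigr do rewrite mxE.
Unshelve. all: by end_near.
Qed.
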